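(* Let $G$ be a finite group, $\omega\in Z^3(G,\mathbb C^\times)$ a 3-cocycle, $\imath:H\hookrightarrow G\times G$ a subgroup embedding with components $\imath_1,\imath_2:H\to G$, and $\theta\in C^2(H,\mathbb C^\times)$ a 2-cochain with $\mathrm d\theta=\imath_1^*\omega\cdot(\imath_2^*\omega)^{-1}$. Assume that $\omega$ is normalized, $\omega(e,b,c)=1$, and has the symmetries of a tetrahedron, $$\omega(a,b,c)=\omega(a^{-1},ab,c)^{-1}=\omega(ab,b^{-1},bc)^{-1}=\omega(a,bc,c^{-1})^{-1},$$ and that $\theta$ is normalized, $\theta(e,b)=1$, and has the symmetries of a triangle, $$\theta(b,a)=\theta(a,a^{-1}b^{-1})=[\theta(a^{-1},b^{-1})]^{-1}.$$ Then the category of $A_{G_{\mathrm{diag}}}$-$A_{H,\theta}$-bimodules in $\mathrm{Vect}(G)^{\omega}\boxtimes\mathrm{Vect}(G)^{\omega^{-1}}$ is equivalent to the functor category (twisted linearization) $$\bigl[\,G\backslash\!\backslash\, G\times G\,/\!/_{\imath^-}H,\ \mathrm{Vect}\,\bigr]^{\tau_{\omega,\theta}}$$ of the action groupoid $G\backslash\!\backslash\, G\times G\,/\!/_{\imath^-}H$ with twist the groupoid 2-cocycle $\tau_{\omega,\theta}$.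
   Context: $\mathrm{Vect}$ denotes finite-dimensional complex vector spaces; $e$ is the neutral element. $\mathrm{Vect}(G)^\omega$ is the finite tensor category of finite-dimensional $G$-graded vector spaces with associator furnished by the cocycle $\omega$; $\boxtimes$ is the Deligne product, so that objects of $\mathrm{Vect}(G)^\omega\boxtimes\mathrm{Vect}(G)^{\omega^{-1}}$ are $G\times G$-graded vector spaces. Algebras in $\mathrm{Vect}(G)^\omega\boxtimes\mathrm{Vect}(G)^{\omega^{-1}}$. $S_{(\gamma_1,\gamma_2)}\cong\mathbb C$ denotes the ground field in homogeneous degree $(\gamma_1,\gamma_2)\in G\times G$. $A_{G_{\mathrm{diag}}}=\bigoplus_{g\in G}S_{(g,g)}$ with the product of the group algebra of $G$. $A_{H,\theta}=\bigoplus_{h\in H}S_{(\imath_1(h)^{-1},\imath_2(h)^{-1})}$ with the algebra structure of a twisted group algebra, with the twist given by the cochain $\theta$. Bimodules have a left action of $A_{G_{\mathrm{diag}}}$ and a commuting right action of $A_{H,\theta}$. Groupoid. $G\backslash\!\backslash\, G\times G\,/\!/_{\imath^-}H$ is the action groupoid of the left action of $G\times H$ on the set $G\times G$ given by $(g,h).(\gamma_1,\gamma_2)=(g\gamma_1\imath_1(h)^{-1},g\gamma_2\imath_2(h)^{-1})$. Twisted linearization. Its objects are finite-dimensional $G\times G$-graded vector spaces $V=\bigoplus V_{(\gamma_1,\gamma_2)}$ with a projective linear left action $\pi$ of $G\times H$, $\pi_{(g,h)}:V_{(\gamma_1,\gamma_2)}\to V_{(g,h).(\gamma_1,\gamma_2)}$,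 satisfying $$\pi_{(g'g,h'h)}|_{V_{(\gamma_1,\gamma_2)}}=\tau_{\omega,\theta}\bigl((\gamma_1,\gamma_2);(g,h),(g',h')\bigr)\;\pi_{(g',h')}\circ\pi_{(g,h)}|_{V_{(\gamma_1,\gamma_2)}} ;$$ morphisms are homogeneous (grading-preserving) linear maps commuting with the action. Here $$\tau_{\omega,\theta}\bigl((\gamma_1,\gamma_2);(g,h),(g',h')\bigr)=\theta(h',h)^{-1}\,\frac{\omega(g',g,\gamma_1)\;\omega\bigl(g'g\gamma_1\imath_1(h)^{-1}\imath_1(h')^{-1},\imath_1(h'),\imath_1(h)\bigr)}{\omega\bigl(g',g\gamma_1\imath_1(h)^{-1},\imath_1(h)\bigr)}\cdot\frac{\omega\bigl(g',g\gamma_2\imath_2(h)^{-1},\imath_2(h)\bigr)}{\omega(g',g,\gamma_2)\;\omega\bigl(g'g\gamma_2\imath_2(h)^{-1}\imath_2(h')^{-1},\imath_2(h'),\imath_2(h)\bigr)} .$$ *)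

(* Defs.v *)
From HB Require Import structures.
From mathcomp Require Import all_boot all_order all_algebra all_fingroup.
From mathcomp Require Import ring boolp reals.

Set Implicit Arguments.
Unset Strict Implicit.
Unset Printing Implicit Defensive.

Import GroupScope GRing.Theory.
Local Open Scope ring_scope.

(* [ccomp g f] is "g after f". *)
Record category := Category {
  cobj :> Type;
  chom : cobj -> cobj -> Type;
  cid : forall X, chom X X;
  ccomp : forall X Y Z, chom Y Z -> chom X Y -> chom X Z;
  ccompA : forall X Y Z T (h : chom Z T) (g : chom Y Z) (f : chom X Y),
    ccomp h (ccomp g f) = ccomp (ccomp h g) f;
  ccomp1m : forall X Y (f : chom X Y), ccomp (cid Y) f = f;
  ccompm1 : forall X Y (f : chom X Y), ccomp f (cid X) = f }.

Arguments cid {c} X.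

Definition is_iso (C : category) (X Y : C) (f : chom X Y) : Prop :=
  exists g : chom Y X, ccomp g f = cid X /\ ccomp f g = cid Y.

Record functor (C D : category) := Functor {
  fobj :> C -> D;
  fmap : forall X Y, chom X Y -> chom (fobj X) (fobj Y);
  fmap1 : forall X, fmap (cid X) = cid (fobj X);
  fmapM : forall X Y Z (g : chom Y Z) (f : chom X Y),
    fmap (ccomp g f) = ccomp (fmap g) (fmap f) }.

Definition functor_id (C : category) : functor C C :=
  @Functor C C id (fun _ _ f => f) (fun=> erefl) (fun _ _ _ _ _ => erefl).

Lemma functor_comp_map1 (C D E : category) (F2 : functor D E)
    (F1 : functor C D) (X : C) : fmap F2 (fmap F1 (cid X)) = cid (F2 (F1 X)).
Proof. by rewrite !fmap1. Qed.

Lemma functor_comp_mapM (C D E : category) (F2 : functor D E)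
    (F1 : functor C D) (X Y Z : C) (g : chom Y Z) (f : chom X Y) :
  fmap F2 (fmap F1 (ccomp g f)) =
  ccomp (fmap F2 (fmap F1 g)) (fmap F2 (fmap F1 f)).
Proof. by rewrite !fmapM. Qed.

Definition functor_comp (C D E : category) (F2 : functor D E)
    (F1 : functor C D) : functor C E :=
  @Functor C E (F2 \o F1) (fun _ _ f => fmap F2 (fmap F1 f))
    (functor_comp_map1 F2 F1) (@functor_comp_mapM _ _ _ F2 F1).

Definition nat_isomorphic (C D : category) (F1 F2 : functor C D) : Prop :=
  exists eta : forall X, chom (F1 X) (F2 X),
    (forall X, is_iso (eta X)) /\
    (forall X Y (f : chom X Y),
       ccomp (eta Y) (fmap F1 f) = ccomp (fmap F2 f) (eta X)).

Definition equivalent (C D : category) : Prop :=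
  exists (F1 : functor C D) (F2 : functor D C),
    nat_isomorphic (functor_comp F2 F1) (functor_id C) /\
    nat_isomorphic (functor_comp F1 F2) (functor_id D).

Record monoidal := Monoidal {
  mcat :> category;
  munit : mcat;
  mtens : mcat -> mcat -> mcat;
  mtensm : forall X X' Y Y' : mcat,
    chom X X' -> chom Y Y' -> chom (mtens X Y) (mtens X' Y');
  massoc : forall X Y Z, chom (mtens (mtens X Y) Z) (mtens X (mtens Y Z));
  mlunit : forall X, chom (mtens munit X) X;
  mrunit : forall X, chom (mtens X munit) X;
  mtensm1 : forall X Y, mtensm (cid X) (cid Y) = cid (mtens X Y);
  mtensmM : forall X X' X'' Y Y' Y'' (g : chom X' X'') (f : chom X X')
      (g' : chom Y' Y'') (f' : chom Y Y'),
    mtensm (ccomp g f) (ccomp g' f') = ccomp (mtensm g g') (mtensm f f');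
  massoc_iso : forall X Y Z, is_iso (massoc X Y Z);
  mlunit_iso : forall X, is_iso (mlunit X);
  mrunit_iso : forall X, is_iso (mrunit X);
  massoc_nat : forall X X' Y Y' Z Z' (f : chom X X') (g : chom Y Y')
      (h : chom Z Z'),
    ccomp (massoc X' Y' Z') (mtensm (mtensm f g) h) =
    ccomp (mtensm f (mtensm g h)) (massoc X Y Z);
  mlunit_nat : forall X X' (f : chom X X'),
    ccomp (mlunit X') (mtensm (cid munit) f) = ccomp f (mlunit X);
  mrunit_nat : forall X X' (f : chom X X'),
    ccomp (mrunit X') (mtensm f (cid munit)) = ccomp f (mrunit X);
  mpentagon : forall X Y Z T,
    ccomp (massoc X Y (mtens Z T)) (massoc (mtens X Y) Z T) =
    ccomp (mtensm (cid X) (massoc Y Z T))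
      (ccomp (massoc X (mtens Y Z) T) (mtensm (massoc X Y Z) (cid T)));
  mtriangle : forall X Y,
    ccomp (mtensm (cid X) (mlunit Y)) (massoc X munit Y) =
    mtensm (mrunit X) (cid Y) }.

Section Bimodules.
Variable M : monoidal.

Record algebra := Algebra {
  acar :> M;
  amul : chom (mtens acar acar) acar;
  aone : chom (munit M) acar;
  amulA : ccomp amul (mtensm amul (cid acar)) =
    ccomp amul (ccomp (mtensm (cid acar) amul) (massoc acar acar acar));
  amul1m : ccomp amul (mtensm aone (cid acar)) = mlunit acar;
  amulm1 : ccomp amul (mtensm (cid acar) aone) = mrunit acar }.

Variables A B : algebra.

(* A left A-action and a right B-action, commuting up to the associator. *)
Record bimodule := Bimodule {
  bcar :> M;
  lact : chom (mtens A bcar) bcar;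
  ract : chom (mtens bcar B) bcar;
  lactA : ccomp lact (mtensm (amul A) (cid bcar)) =
    ccomp lact (ccomp (mtensm (cid (acar A)) lact) (massoc (acar A) A bcar));
  lact1 : ccomp lact (mtensm (aone A) (cid bcar)) = mlunit bcar;
  ractA : ccomp ract (mtensm ract (cid (acar B))) =
    ccomp ract (ccomp (mtensm (cid bcar) (amul B)) (massoc bcar B B));
  ract1 : ccomp ract (mtensm (cid bcar) (aone B)) = mrunit bcar;
  lractA : ccomp ract (mtensm lact (cid (acar B))) =
    ccomp lact (ccomp (mtensm (cid (acar A)) ract) (massoc (acar A) bcar B)) }.

Definition is_bimodule_hom (X Y : bimodule) (f : chom (bcar X) (bcar Y)) :=
  ccomp f (lact X) = ccomp (lact Y) (mtensm (cid (acar A)) f) /\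
  ccomp f (ract X) = ccomp (ract Y) (mtensm f (cid (acar B))).

Definition bimodule_hom (X Y : bimodule) := {f | @is_bimodule_hom X Y f}.

Lemma bimodule_hom_eq X Y (f g : bimodule_hom X Y) : sval f = sval g -> f = g.
Proof.
case: f g => [f fP] [g gP] /= fg; case: _ / fg gP => gP.
by rewrite (Prop_irrelevance fP gP).
Qed.

Fact bimodule_id_subproof X : is_bimodule_hom (cid (bcar X)).
Proof. by split; rewrite mtensm1 ccompm1 ccomp1m. Qed.

Fact bimodule_comp_subproof X Y Z (g : bimodule_hom Y Z)
  (f : bimodule_hom X Y) : is_bimodule_hom (ccomp (sval g) (sval f)).
Proof.
case: g f => [g [gl gr]] [f [fl fr]] /=; split.
- by rewrite -ccompA fl ccompA gl -ccompA -mtensmM ccomp1m.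
- by rewrite -ccompA fr ccompA gr -ccompA -mtensmM ccomp1m.
Qed.

Definition bimodule_id X : bimodule_hom X X := exist _ _ (bimodule_id_subproof X).
Definition bimodule_comp X Y Z (g : bimodule_hom Y Z) (f : bimodule_hom X Y) :
  bimodule_hom X Z := exist _ _ (bimodule_comp_subproof g f).

Fact bimodule_compA X Y Z T (h : bimodule_hom Z T) (g : bimodule_hom Y Z)
    (f : bimodule_hom X Y) :
  bimodule_comp h (bimodule_comp g f) = bimodule_comp (bimodule_comp h g) f.
Proof. by apply: bimodule_hom_eq; rewrite /= ccompA. Qed.

Fact bimodule_comp1m X Y (f : bimodule_hom X Y) :
  bimodule_comp (bimodule_id Y) f = f.
Proof. by apply: bimodule_hom_eq; rewrite /= ccomp1m. Qed.

Fact bimodule_compm1 X Y (f : bimodule_hom X Y) :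
  bimodule_comp f (bimodule_id X) = f.
Proof. by apply: bimodule_hom_eq; rewrite /= ccompm1. Qed.

Definition bimodule_category : category :=
  Category bimodule_compA bimodule_comp1m bimodule_compm1.

End Bimodules.

(* The model of the tensor product is the space of coordinate matrices in
   chosen bases; [tlift_tens] and [tens_ext] are its universal
   property, and nothing below depends on the choice of bases. *)
Section VectTensor.
Variable F : fieldType.
Implicit Types V W U : vectType F.

Definition tprod V W : vectType F := 'M[F]_(\dim {:V}, \dim {:W}).

Definition vbase V (i : 'I_(\dim {:V})) : V := (vbasis {:V})`_i.
Definition vcoord V (i : 'I_(\dim {:V})) (v : V) : F := coord (vbasis {:V}) i v.

Definition tens V W (v : V) (w : W) : tprod V W :=
  \matrix_(i, j) (vcoord i v * vcoord j w).

Definition bilin V W U (b : V -> W -> U) :=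
  (forall v, linear (b v)) /\ (forall w, linear (b^~ w)).

Definition tlift V W U (b : V -> W -> U) : 'Hom(tprod V W, U) :=
  linfun (fun t : tprod V W =>
    \sum_i \sum_j (t : 'M_(_, _)) i j *: b (vbase i) (vbase j)).

Lemma linfunE V W (f : V -> W) : linear f -> linfun f =1 f.
Proof.
move=> lf x; pose LF := GRing.isLinear.Build _ _ _ _ f lf.
pose ff : {linear _ -> _} := HB.pack f LF.
exact: (lfunE ff).
Qed.

Lemma tliftE V W U (b : V -> W -> U) (t : tprod V W) :
  tlift b t = \sum_i \sum_j (t : 'M_(_, _)) i j *: b (vbase i) (vbase j).
Proof.
rewrite /tlift linfunE // => k x y.
rewrite scaler_sumr -big_split /=; apply: eq_bigr => i _.
rewrite scaler_sumr -big_split /=; apply: eq_bigr => j _.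
by rewrite !mxE scalerDl scalerA.
Qed.

Lemma tens_bilin V W : bilin (@tens V W).
Proof.
split=> u k x y; apply/matrixP=> i j; rewrite !mxE /vcoord linearP.
  by rewrite mulrDr mulrCA.
by rewrite mulrDl mulrA.
Qed.

Lemma vbase_sum V (v : V) : v = \sum_i vcoord i v *: vbase i.
Proof. exact/coord_vbasis/memvf. Qed.

Lemma vcoord_base V (i j : 'I_(\dim {:V})) : vcoord i (vbase j) = (i == j)%:R.
Proof. by rewrite /vcoord /vbase coord_free 1?eq_sym ?(basis_free (vbasisP _)). Qed.

Lemma linearf_sum V W (f : V -> W) (I : Type) (r : seq I) (P : pred I)
    (c : I -> F) (v : I -> V) : linear f ->
  f (\sum_(i <- r | P i) c i *: v i) = \sum_(i <- r | P i) c i *: f (v i).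
Proof.
move=> /linfunE fE; rewrite -fE linear_sum; apply: eq_bigr => i _ /=.
by rewrite linearZ /= fE.
Qed.

Lemma tlift_tens V W U (b : V -> W -> U) v w : bilin b ->
  tlift b (tens v w) = b v w.
Proof.
case=> b1 b2; rewrite tliftE {2}[v]vbase_sum (linearf_sum _ _ _ _ (b2 _)).
apply: eq_bigr => i _; rewrite [w in RHS]vbase_sum (linearf_sum _ _ _ _ (b1 _)).
rewrite scaler_sumr; apply: eq_bigr => j _; rewrite scalerA.
by rewrite !mxE.
Qed.

Lemma tprod_sum V W (t : tprod V W) :
  t = \sum_i \sum_j (t : 'M_(_, _)) i j *: tens (vbase i) (vbase j).
Proof.
rewrite {1}[t]matrix_sum_delta; apply: eq_bigr => i _; apply: eq_bigr => j _.
congr (_ *: _); apply/matrixP=> k l.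
by rewrite !mxE !vcoord_base -natrM mulnb.
Qed.

Lemma tens_extl V W U (f g : tprod V W -> U) : linear f -> linear g ->
  (forall v w, f (tens v w) = g (tens v w)) -> f =1 g.
Proof.
move=> lf lg fg t; rewrite [t]tprod_sum.
rewrite -(linfunE lf) -(linfunE lg) !linear_sum; apply: eq_bigr => i _.
rewrite !linear_sum; apply: eq_bigr => j _.
by rewrite !linearZ /= (linfunE lf) (linfunE lg) fg.
Qed.

Lemma tens_ext V W U (f g : 'Hom(tprod V W, U)) :
  (forall v w, f (tens v w) = g (tens v w)) -> f = g.
Proof.
by move=> fg; apply/lfunP; apply: tens_extl fg => k x y; rewrite linearP.
Qed.

Definition tmap V V' W W' (f : 'Hom(V, V')) (g : 'Hom(W, W')) :
  'Hom(tprod V W, tprod V' W') := tlift (fun v w => tens (f v) (g w)).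

Lemma tmap_tens V V' W W' (f : 'Hom(V, V')) (g : 'Hom(W, W')) v w :
  tmap f g (tens v w) = tens (f v) (g w).
Proof.
apply: tlift_tens; have [t1 t2] := tens_bilin V' W'.
by split=> x k y z /=; rewrite linearP ?t1 ?t2.
Qed.

Definition tsub V W (A : {vspace V}) (B : {vspace W}) : {vspace tprod V W} :=
  <<[seq tens v w | v <- vbasis A, w <- vbasis B]>>%VS.

End VectTensor.
Section TensorSubspaces.
Variable F : fieldType.
Implicit Types V W U : vectType F.

Lemma mem_tsub V W (A : {vspace V}) (B : {vspace W}) v w :
  v \in A -> w \in B -> tens v w \in tsub A B.
Proof.
move=> vA wB; have [t1 t2] := tens_bilin V W.
rewrite (coord_vbasis vA) (linearf_sum _ _ _ _ (t2 _)).
apply: rpred_sum => i _; apply: rpredZ.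
rewrite (coord_vbasis wB) (linearf_sum _ _ _ _ (t1 _)).
apply: rpred_sum => j _; apply: rpredZ; apply/memv_span/allpairsP.
by exists ((vbasis A)`_i, (vbasis B)`_j); split; rewrite ?mem_nth ?size_tuple.
Qed.

Lemma tsub_subP V W (A : {vspace V}) (B : {vspace W})
    (C : {vspace tprod V W}) :
  (forall v w, v \in A -> w \in B -> tens v w \in C) -> (tsub A B <= C)%VS.
Proof.
move=> AB; apply/span_subvP => _ /allpairsP[[v w] /= [vA wB ->]].
by apply: AB; apply: vbasis_mem.
Qed.

Lemma linear_tensl V W U (f : tprod V W -> U) (w : W) :
  linear f -> linear (fun v => f (tens v w)).
Proof. by move=> lf k x y; rewrite (tens_bilin V W).2 lf. Qed.

Lemma linear_tensr V W U (f : tprod V W -> U) (v : V) :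
  linear f -> linear (fun w => f (tens v w)).
Proof. by move=> lf k x y; rewrite (tens_bilin V W).1 lf. Qed.

Lemma linear_lfun V W (f : 'Hom(V, W)) : linear f.
Proof. exact: linearP. Qed.

End TensorSubspaces.

Section Graded.
Variables (F : fieldType) (X : finType).

(* Stated on an abstract family because [directv] inspects the syntax of the
   summands: for a family of sums it would ask for more. *)
Definition direct_family (V : vectType F) (U : X -> {vspace V}) : bool :=
  directv (\sum_x U x).

Record gvect := GVect {
  gcar :> vectType F;
  gcomp : X -> {vspace gcar};
  gcomp_sum : (\sum_x gcomp x)%VS = fullv;
  gcomp_direct : direct_family gcomp }.

Implicit Types V W U : gvect.

Definition gproj V (x : X) : 'End(V) := sumv_pi_for (esym (gcomp_sum V)) x.

Lemma gproj_mem V x (v : V) : gproj V x v \in gcomp V x.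
Proof. exact: memv_sum_pi. Qed.

Lemma gproj_sum V (v : V) : \sum_x gproj V x v = v.
Proof. exact/sumv_pi_sum/memvf. Qed.

Lemma gproj_id V x y (v : V) :
  v \in gcomp V x -> gproj V y v = if y == x then v else 0.
Proof.
move=> vx; have /directv_sum_unique/(_ (fun z => gproj V z v)
  (fun z => if z == x then v else 0)) := gcomp_direct V.
rewrite gproj_sum -big_mkcond big_pred1_eq eqxx => E.
apply/eqP/(forall_inP (esym (E _ _))) => // z _; first exact: gproj_mem.
by case: eqP => [->//|_]; rewrite mem0v.
Qed.

Lemma gproj_sum1 V (U : nmodType) x (v : V) (f : X -> V -> U) :
  v \in gcomp V x -> (forall y, f y 0 = 0) ->
  \sum_y f y (gproj V y v) = f x v.
Proof.
move=> vx f0; rewrite (bigD1 x) //= (gproj_id x vx) eqxx big1 ?addr0 // => y.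
by move=> /negPf yx; rewrite (gproj_id y vx) yx f0.
Qed.

Lemma gextl V (U : vectType F) (f g : V -> U) : linear f -> linear g ->
  (forall x v, v \in gcomp V x -> f v = g v) -> f =1 g.
Proof.
move=> lf lg fg v; rewrite -(gproj_sum v).
rewrite -(linfunE lf) -(linfunE lg) !linear_sum; apply: eq_bigr => x _.
by rewrite /= (linfunE lf) (linfunE lg) (fg _ _ (gproj_mem x v)).
Qed.

Definition homogeneous V W (f : 'Hom(V, W)) : bool :=
  [forall x, (f @: gcomp V x <= gcomp W x)%VS].

Lemma homogeneousP V W (f : 'Hom(V, W)) :
  reflect (forall x v, v \in gcomp V x -> f v \in gcomp W x) (homogeneous f).
Proof.
apply: (iffP forallP) => fP x; first by move=> v vx; apply/(subvP (fP x))/memv_img.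
by apply/subvP => _ /memv_imgP[v vx ->]; apply: fP.
Qed.

Definition ghom V W := {f : 'Hom(V, W) | homogeneous f}.

Lemma ghomP V W (f : ghom V W) x v : v \in gcomp V x -> val f v \in gcomp W x.
Proof. by move: x v; apply/homogeneousP/(valP f). Qed.

Fact ghom_id_subproof V : homogeneous (\1%VF : 'End(V)).
Proof. by apply/homogeneousP => x v; rewrite id_lfunE. Qed.

Fact ghom_comp_subproof V W U (g : ghom W U) (f : ghom V W) :
  homogeneous (val g \o val f)%VF.
Proof. by apply/homogeneousP => x v vx; rewrite comp_lfunE !ghomP. Qed.

Definition ghom_id V : ghom V V := Sub _ (ghom_id_subproof V).
Definition ghom_comp V W U (g : ghom W U) (f : ghom V W) : ghom V U :=
  Sub _ (ghom_comp_subproof g f).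

Fact ghom_compA V W U T (h : ghom U T) (g : ghom W U) (f : ghom V W) :
  ghom_comp h (ghom_comp g f) = ghom_comp (ghom_comp h g) f.
Proof. by apply/val_inj; rewrite /= comp_lfunA. Qed.

Fact ghom_comp1m V W (f : ghom V W) : ghom_comp (ghom_id W) f = f.
Proof. by apply/val_inj; rewrite /= comp_lfun1l. Qed.

Fact ghom_compm1 V W (f : ghom V W) : ghom_comp f (ghom_id V) = f.
Proof. by apply/val_inj; rewrite /= comp_lfun1r. Qed.

Definition gvect_category : category :=
  Category ghom_compA ghom_comp1m ghom_compm1.

Definition gscale (c : X -> F) V : 'End(V) := (\sum_x c x *: gproj V x)%R.

Lemma gscaleE c V x (v : V) : v \in gcomp V x -> gscale c V v = c x *: v.
Proof.
move=> vx; rewrite sum_lfunE -(gproj_sum1 (f := fun y u => c y *: u) vx).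
  by apply: eq_bigr => y _; rewrite scale_lfunE.
by move=> y; rewrite scaler0.
Qed.

(* The space freely spanned by a finite set [I] with the basis vector at [i]
   in degree [d i]; that is, the direct sum of the [S_(d i)]. *)
Section Span.
Variables (I : finType) (d : I -> X).

Definition gdelta (i : I) : {ffun I -> F^o} := [ffun j => (j == i)%:R].

Definition gspan_comp (x : X) : {vspace {ffun I -> F^o}} :=
  <<[seq gdelta i | i <- enum [pred i | d i == x]]>>%VS.

Lemma gdelta_mem i : gdelta i \in gspan_comp (d i).
Proof. by apply/memv_span/map_f; rewrite mem_enum inE. Qed.

Lemma gdelta_sum (v : {ffun I -> F^o}) : v = \sum_i v i *: gdelta i.
Proof.
apply/ffunP => j; rewrite sum_ffunE (bigD1 j) //= !ffunE eqxx big1 ?addr0.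
  by rewrite /GRing.scale /= mulr1.
by move=> i /negPf ij; rewrite !ffunE eq_sym ij scaler0.
Qed.

Lemma gspan_compP x (v : {ffun I -> F^o}) :
  reflect (forall i, d i != x -> v i = 0) (v \in gspan_comp x).
Proof.
apply: (iffP idP) => [|v0].
  move=> /coord_span-> i dx; rewrite sum_ffunE big1 // => k _; rewrite ffunE.
  have : [seq gdelta i | i <- enum [pred i | d i == x]]`_k
    \in [seq gdelta i | i <- enum [pred i | d i == x]].
    by rewrite mem_nth // size_map -cardE.
  case/mapP => j; rewrite mem_enum inE => /eqP dj ->; rewrite ffunE.
  by have [E|_] := eqVneq i j; rewrite ?scaler0 // E dj eqxx in dx *.
rewrite [v]gdelta_sum; apply: rpred_sum => i _.
have [<-|dx] := eqVneq (d i) x; first exact/rpredZ/gdelta_mem.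
by rewrite v0 // scale0r mem0v.
Qed.

Fact gspan_sum : (\sum_x gspan_comp x)%VS = fullv.
Proof.
apply/eqP; rewrite eqEsubv subvf; apply/subvP => v _; rewrite [v]gdelta_sum.
apply: rpred_sum => i _; apply: rpredZ.
exact: (subvP (sumv_sup (d i) _ (subvv _))) (gdelta_mem i).
Qed.

Fact gspan_direct : direct_family gspan_comp.
Proof.
apply/directv_sum_independent => u uP us x _; apply/ffunP => i; rewrite [RHS]ffunE.
have [dx|dx] := eqVneq (d i) x; last by have /gspan_compP-> := uP x isT.
have := congr1 (fun f : {ffun I -> F^o} => f i) us.
rewrite sum_ffunE (bigD1 x) //= [X in _ = X]ffunE big1 ?addr0 // => y /negPf yx.
by have /gspan_compP-> := uP y isT; rewrite // dx eq_sym yx.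
Qed.

Definition gspan : gvect := GVect gspan_sum gspan_direct.

End Span.

End Graded.

Arguments gdelta F {I} i.
Arguments gspan F {X I} d.

Section GradedTensor.
Variables (F : fieldType) (G : finGroupType).
Implicit Types V W U T : gvect F G.

Definition gtens_comp V W (x : G) : {vspace tprod V W} :=
  (\sum_a tsub (gcomp V a) (gcomp W (a^-1 * x)%g))%VS.

Lemma gtens_mem V W a b v w : v \in gcomp V a -> w \in gcomp W b ->
  tens v w \in gtens_comp V W (a * b)%g.
Proof.
move=> va wb; apply: (subvP (sumv_sup a _ (subvv _))) => //.
by apply: mem_tsub; rewrite ?mulKg.
Qed.

Lemma gtens_comp_subP V W x (C : {vspace tprod V W}) :
  (forall a b v w, (a * b)%g = x -> v \in gcomp V a -> w \in gcomp W b ->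
    tens v w \in C) -> (gtens_comp V W x <= C)%VS.
Proof.
move=> VW; apply/subv_sumP => a _; apply: tsub_subP => v w va wb.
by apply: VW va wb; rewrite mulKVg.
Qed.

Let gtproj V W x : 'End(tprod V W) :=
  (\sum_a tmap (gproj V a) (gproj W (a^-1 * x)%g))%R.

Let gtproj_id V W x y t : t \in gtens_comp V W x ->
  gtproj V W y t = if y == x then t else 0.
Proof.
suff: (gtens_comp V W x <= lker (gtproj V W y - (y == x)%:R *: \1%VF))%VS.
  move=> /subvP tP /tP; rewrite memv_ker add_lfunE opp_lfunE scale_lfunE.
  by rewrite id_lfunE subr_eq0 => /eqP->; case: eqP; rewrite ?scale1r ?scale0r.
apply: gtens_comp_subP => a b v w <- va wb.
rewrite memv_ker add_lfunE opp_lfunE scale_lfunE id_lfunE subr_eq0 sum_lfunE.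
have [t1 t2] := tens_bilin V W.
rewrite (eq_bigr (fun a' => tens (gproj V a' v) (gproj W (a'^-1 * y)%g w))); last first.
  by move=> a' _; rewrite tmap_tens.
have t0 (v' : V) : tens v' (0 : W) = 0.
  by rewrite -(linfunE (t1 v')) linear0.
have t0' (w' : W) : tens (0 : V) w' = 0.
  by rewrite -(linfunE (t2 w')) linear0.
rewrite (gproj_sum1 (f := fun a' v' => tens v' (gproj W (a'^-1 * y)%g w)) va) //.
rewrite (gproj_id _ wb) -(inj_eq (mulgI a)) mulKVg.
by case: (y == _); rewrite ?scale1r ?scale0r ?t0.
Qed.

Fact gtens_sum V W : (\sum_x gtens_comp V W x)%VS = fullv.
Proof.
apply/eqP; rewrite eqEsubv subvf; apply/subvP => t _; rewrite [t]tprod_sum.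
apply: rpred_sum => i _; apply: rpred_sum => j _; apply: rpredZ.
have [t1 t2] := tens_bilin V W.
rewrite -(gproj_sum (vbase i)) -(gproj_sum (vbase j)).
rewrite -(linfunE (t2 _)) linear_sum; apply: rpred_sum => a _.
rewrite /= (linfunE (t2 _)) -(linfunE (t1 _)) linear_sum; apply: rpred_sum => b _.
rewrite /= (linfunE (t1 _)); apply: (subvP (sumv_sup (a * b)%g _ (subvv _))) => //.
exact: gtens_mem (gproj_mem _ _) (gproj_mem _ _).
Qed.

Fact gtens_direct V W : direct_family (gtens_comp V W).
Proof.
apply/directv_sum_independent => u uP us x _.
have := congr1 (gtproj V W x) us; rewrite linear0 linear_sum (bigD1 x) //=.
rewrite (gtproj_id x (uP x isT)) eqxx big1 ?addr0 // => y /negPf yx.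
by rewrite (gtproj_id x (uP y isT)) eq_sym yx.
Qed.

Definition gtens V W : gvect F G := GVect (gtens_sum V W) (gtens_direct V W).

Lemma tens_mem V W a b v w : v \in gcomp V a -> w \in gcomp W b ->
  tens v w \in gcomp (gtens V W) (a * b)%g.
Proof. exact: gtens_mem. Qed.

Lemma gtens_extl V W (U : vectType F) (f g : gtens V W -> U) :
  linear f -> linear g ->
  (forall a b v w, v \in gcomp V a -> w \in gcomp W b ->
     f (tens v w) = g (tens v w)) -> f =1 g.
Proof.
move=> lf lg fg; apply: tens_extl => // v w; move: v.
apply: gextl; [exact: linear_tensl | exact: linear_tensl | move=> a v va].
move: w; apply: gextl; [exact: linear_tensr | exact: linear_tensr |].
by move=> b w wb; apply: fg va wb.
Qed.

Lemma gtens_ext V W (U : vectType F) (f g : 'Hom(gtens V W, U)) :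
  (forall a b v w, v \in gcomp V a -> w \in gcomp W b ->
     f (tens v w) = g (tens v w)) -> f = g.
Proof.
by move=> fg; apply/lfunP; apply: gtens_extl fg; apply: linear_lfun.
Qed.

Lemma gtens_ext3l V W T (U : vectType F) (f g : gtens (gtens V W) T -> U) :
  linear f -> linear g ->
  (forall a b c v w t, v \in gcomp V a -> w \in gcomp W b -> t \in gcomp T c ->
     f (tens (tens v w : gtens V W) t) = g (tens (tens v w : gtens V W) t)) ->
  f =1 g.
Proof.
move=> lf lg fg; apply: tens_extl => // s t; move: t.
apply: gextl; [exact: linear_tensr | exact: linear_tensr | move=> c t tc].
move: s; apply: gtens_extl; [exact: linear_tensl | exact: linear_tensl |].
by move=> a b v w va wb; apply: fg va wb tc.
Qed.

Lemma gtens_ext3r V W T (U : vectType F) (f g : 'Hom(gtens V (gtens W T), U)) :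
  (forall a b c v w t, v \in gcomp V a -> w \in gcomp W b -> t \in gcomp T c ->
     f (tens v (tens w t : gtens W T)) = g (tens v (tens w t : gtens W T))) ->
  f = g.
Proof.
move=> fg; have [lf lg] := (linear_lfun f, linear_lfun g); apply/lfunP.
apply: tens_extl => // v s; move: v.
apply: gextl; [exact: linear_tensl | exact: linear_tensl | move=> a v va].
move: s; apply: gtens_extl; [exact: linear_tensr | exact: linear_tensr |].
by move=> b c w t wb tc; apply: fg va wb tc.
Qed.

Lemma gtens_ext3 V W T (U : vectType F) (f g : 'Hom(gtens (gtens V W) T, U)) :
  (forall a b c v w t, v \in gcomp V a -> w \in gcomp W b -> t \in gcomp T c ->
     f (tens (tens v w : gtens V W) t) = g (tens (tens v w : gtens V W) t)) ->
  f = g.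
Proof.
by move=> fg; apply/lfunP; apply: gtens_ext3l fg; apply: linear_lfun.
Qed.

Lemma gtens_ext4 V W T S (U : vectType F)
    (f g : 'Hom(gtens (gtens (gtens V W) T) S, U)) :
  (forall a b c d v w t s, v \in gcomp V a -> w \in gcomp W b ->
     t \in gcomp T c -> s \in gcomp S d ->
     f (tens (tens (tens v w : gtens V W) t : gtens (gtens V W) T) s) =
     g (tens (tens (tens v w : gtens V W) t : gtens (gtens V W) T) s)) ->
  f = g.
Proof.
move=> fg; have [lf lg] := (linear_lfun f, linear_lfun g); apply/lfunP.
apply: tens_extl => // r s; move: s.
apply: gextl; [exact: linear_tensr | exact: linear_tensr | move=> d s sd].
move: r; apply: gtens_ext3l; [exact: linear_tensl | exact: linear_tensl |].
by move=> a b c v w t va wb tc; apply: fg va wb tc sd.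
Qed.

Fact gtensm_subproof V V' W W' (f : ghom V V') (g : ghom W W') :
  homogeneous (tmap (val f) (val g) : 'Hom(gtens V W, gtens V' W')).
Proof.
apply/homogeneousP => x t tx; rewrite memv_preim; apply: subvP t tx.
apply: gtens_comp_subP => a b v w <- va wb; rewrite -memv_preim tmap_tens.
by apply: gtens_mem; apply: ghomP.
Qed.

Definition gtensm V V' W W' (f : ghom V V') (g : ghom W W') :
  ghom (gtens V W) (gtens V' W') := Sub _ (gtensm_subproof f g).

End GradedTensor.

Section PlainAssociator.
Variable F : fieldType.
Implicit Types V W U : vectType F.

Lemma tensZl V W k (v : V) (w : W) : tens (k *: v) w = k *: tens v w.
Proof. by rewrite -!(linfunE ((tens_bilin V W).2 w)) linearZ. Qed.

Lemma tensZr V W k (v : V) (w : W) : tens v (k *: w) = k *: tens v w.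
Proof. by rewrite -!(linfunE ((tens_bilin V W).1 v)) linearZ. Qed.

Lemma lfunZ V W (f : 'Hom(V, W)) k v : f (k *: v) = k *: f v.
Proof. by rewrite linearZ. Qed.

Lemma lfun_sum V W (f : 'Hom(V, W)) (I : Type) (r : seq I) (v : I -> V) :
  f (\sum_(i <- r) v i) = \sum_(i <- r) f (v i).
Proof. exact: linear_sum. Qed.

Lemma tens0l V W (w : W) : tens (0 : V) w = 0.
Proof. by rewrite -(scale0r 0) tensZl scale0r. Qed.

Lemma tens0r V W (v : V) : tens v (0 : W) = 0.
Proof. by rewrite -(scale0r 0) tensZr scale0r. Qed.

Definition tassoc U V W : 'Hom(tprod (tprod U V) W, tprod U (tprod V W)) :=
  tlift (fun t w => tlift (fun u v => tens u (tens v w)) t).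

Definition tassocV U V W : 'Hom(tprod U (tprod V W), tprod (tprod U V) W) :=
  tlift (fun u t => tlift (fun v w => tens (tens u v) w) t).

Lemma tassoc_tens U V W (u : U) (v : V) (w : W) :
  tassoc U V W (tens (tens u v) w) = tens u (tens v w).
Proof.
have b (w' : W) : bilin (fun (u : U) (v : V) => tens u (tens v w')).
  by split=> x k y z; rewrite ?(tens_bilin V W).2 ?(tens_bilin U (tprod V W)).1
    ?(tens_bilin U (tprod V W)).2.
rewrite /tassoc tlift_tens; first exact: tlift_tens.
split=> [t k x y|w' k x y]; last by rewrite linearP.
rewrite !tliftE scaler_sumr -big_split; apply: eq_bigr => i _ /=.
rewrite scaler_sumr -big_split; apply: eq_bigr => j _ /=.
rewrite (tens_bilin V W).1 (tens_bilin U (tprod V W)).1 scalerDr !scalerA.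
by rewrite mulrC.
Qed.

Lemma tassocV_tens U V W (u : U) (v : V) (w : W) :
  tassocV U V W (tens u (tens v w)) = tens (tens u v) w.
Proof.
have b (u' : U) : bilin (fun (v : V) (w : W) => tens (tens u' v) w).
  by split=> x k y z; rewrite ?(tens_bilin U V).1 ?(tens_bilin (tprod U V) W).1
    ?(tens_bilin (tprod U V) W).2.
rewrite /tassocV tlift_tens; first exact: tlift_tens.
split=> [u' k x y|t k x y]; first by rewrite linearP.
rewrite !tliftE scaler_sumr -big_split; apply: eq_bigr => i _ /=.
rewrite scaler_sumr -big_split; apply: eq_bigr => j _ /=.
rewrite (tens_bilin U V).2 (tens_bilin (tprod U V) W).2 scalerDr !scalerA.
by rewrite mulrC.
Qed.

End PlainAssociator.

Section Cochains.
Variables (F : fieldType) (G : finGroupType).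

(* Cochains take values in the multiplicative group of [F]. *)
Record cochain2 := Cochain2 {
  c2fun :> G -> G -> F;
  c2_neq0 : forall a b, c2fun a b != 0 }.

Definition d2 (t : cochain2) (a b c : G) : F :=
  t b c * t a (b * c)%g / (t (a * b)%g c * t a b).

Record cocycle3 := Cocycle3 {
  c3fun :> G -> G -> G -> F;
  c3_neq0 : forall a b c, c3fun a b c != 0;
  c3P : forall a b c d,
    c3fun b c d * c3fun a (b * c)%g d * c3fun a b c =
    c3fun (a * b)%g c d * c3fun a b (c * d)%g }.

Definition normalized2 (t : cochain2) : Prop := forall b, t 1%g b = 1.
Definition normalized3 (w : cocycle3) : Prop := forall b c, w 1%g b c = 1.

Definition triangle_symmetric (t : cochain2) : Prop :=
  forall a b, t b a = t a (a^-1 * b^-1)%g /\ t b a = (t a^-1%g b^-1%g)^-1.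

Definition tetrahedron_symmetric (w : cocycle3) : Prop :=
  forall a b c,
    [/\ w a b c = (w a^-1%g (a * b)%g c)^-1,
        w a b c = (w (a * b)%g b^-1%g (b * c)%g)^-1
      & w a b c = (w a (b * c)%g c^-1%g)^-1].

Fact cocycle3_inv_neq0 (w : cocycle3) a b c : (w a b c)^-1 != 0.
Proof. by rewrite invr_eq0 c3_neq0. Qed.

Fact cocycle3_invP (w : cocycle3) a b c d :
  (w b c d)^-1 * (w a (b * c)%g d)^-1 * (w a b c)^-1 =
  (w (a * b)%g c d)^-1 * (w a b (c * d)%g)^-1.
Proof. by rewrite -!invfM c3P. Qed.

Definition cocycle3_inv (w : cocycle3) : cocycle3 :=
  Cocycle3 (cocycle3_inv_neq0 w) (cocycle3_invP w).

End Cochains.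

Section TwistedVect.
Variables (F : fieldType) (G : finGroupType).
Implicit Types V W U T : gvect F G.

(* (u (x) v) (x) t |-> c(a, b, d) u (x) (v (x) t) for u, v, t homogeneous of
   degrees a, b, d; with c a 3-cocycle this is the associator of Vect(G)^c. *)
Definition wassoc (c : G -> G -> G -> F) U V W :
    'Hom(gtens (gtens U V) W, gtens U (gtens V W)) :=
  (\sum_a \sum_b \sum_d c a b d *:
     (tmap (gproj U a) (tmap (gproj V b) (gproj W d)) \o tassoc U V W)%VF)%R.

Definition wassocV (c : G -> G -> G -> F) U V W :
    'Hom(gtens U (gtens V W), gtens (gtens U V) W) :=
  (\sum_a \sum_b \sum_d c a b d *:
     (tmap (tmap (gproj U a) (gproj V b)) (gproj W d) \o tassocV U V W)%VF)%R.

Lemma wassoc_tens c U V W a b d u v w :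
  u \in gcomp U a -> v \in gcomp V b -> w \in gcomp W d ->
  wassoc c U V W (tens (tens u v : gtens U V) w) =
  c a b d *: tens u (tens v w : gtens V W).
Proof.
move=> ua vb wd; rewrite sum_lfunE.
transitivity (\sum_a' \sum_b' \sum_d' c a' b' d' *:
  tens (gproj U a' u) (tens (gproj V b' v) (gproj W d' w))).
  apply: eq_bigr => a' _; rewrite sum_lfunE; apply: eq_bigr => b' _.
  rewrite sum_lfunE; apply: eq_bigr => d' _.
  by rewrite scale_lfunE comp_lfunE tassoc_tens !tmap_tens.
rewrite (gproj_sum1 (f := fun a' u' => \sum_b' \sum_d' c a' b' d' *:
  tens u' (tens (gproj V b' v) (gproj W d' w))) ua) => [|a']; last first.
  by do 2 (rewrite big1 // => ? _); rewrite tens0l scaler0.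
rewrite (gproj_sum1 (f := fun b' v' => \sum_d' c a b' d' *:
  tens u (tens v' (gproj W d' w))) vb) => [|b']; last first.
  by rewrite big1 // => ? _; rewrite tens0l tens0r scaler0.
by rewrite (gproj_sum1 (f := fun d' w' => c a b d' *: tens u (tens v w')) wd)
  => [//|d']; rewrite !tens0r scaler0.
Qed.

Lemma wassocV_tens c U V W a b d u v w :
  u \in gcomp U a -> v \in gcomp V b -> w \in gcomp W d ->
  wassocV c U V W (tens u (tens v w : gtens V W)) =
  c a b d *: tens (tens u v : gtens U V) w.
Proof.
move=> ua vb wd; rewrite sum_lfunE.
transitivity (\sum_a' \sum_b' \sum_d' c a' b' d' *:
  tens (tens (gproj U a' u) (gproj V b' v)) (gproj W d' w)).
  apply: eq_bigr => a' _; rewrite sum_lfunE; apply: eq_bigr => b' _.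
  rewrite sum_lfunE; apply: eq_bigr => d' _.
  by rewrite scale_lfunE comp_lfunE tassocV_tens !tmap_tens.
rewrite (gproj_sum1 (f := fun a' u' => \sum_b' \sum_d' c a' b' d' *:
  tens (tens u' (gproj V b' v)) (gproj W d' w)) ua) => [|a']; last first.
  by do 2 (rewrite big1 // => ? _); rewrite !tens0l scaler0.
rewrite (gproj_sum1 (f := fun b' v' => \sum_d' c a b' d' *:
  tens (tens u v') (gproj W d' w)) vb) => [|b']; last first.
  by rewrite big1 // => ? _; rewrite tens0r tens0l scaler0.
by rewrite (gproj_sum1 (f := fun d' w' => c a b d' *: tens (tens u v) w') wd)
  => [//|d']; rewrite !tens0r scaler0.
Qed.

Fact wassoc_subproof c U V W : homogeneous (wassoc c U V W).
Proof.
apply/homogeneousP => x t tx; rewrite memv_preim; apply: subvP t tx.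
apply: gtens_comp_subP => y d s w <-; rewrite -memv_preim => sy wd.
rewrite memv_preim.
have: (gtens_comp U V y <= (wassoc c U V W \o linfun (fun s => tens s w : gtens (gtens U V) W)) @^-1: gcomp (gtens U (gtens V W)) (y * d)%g)%VS.
  apply: gtens_comp_subP => a b u v <- ua vb; rewrite -memv_preim comp_lfunE.
  rewrite (linfunE ((tens_bilin _ _).2 w)) (wassoc_tens _ ua vb wd).
  by apply: rpredZ; rewrite -mulgA; do 2 (apply: gtens_mem => //).
move=> /subvP/(_ s sy); rewrite -!memv_preim comp_lfunE.
by rewrite (linfunE ((tens_bilin _ _).2 w)).
Qed.

Fact wassocV_subproof c U V W : homogeneous (wassocV c U V W).
Proof.
apply/homogeneousP => x t tx; rewrite memv_preim; apply: subvP t tx.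
apply: gtens_comp_subP => a y u s <- ua sy; rewrite -memv_preim.
have: (gtens_comp V W y <= (wassocV c U V W \o linfun (fun s => tens u s : gtens U (gtens V W))) @^-1: gcomp (gtens (gtens U V) W) (a * y)%g)%VS.
  apply: gtens_comp_subP => b d v w <- vb wd; rewrite -memv_preim comp_lfunE.
  rewrite (linfunE ((tens_bilin _ _).1 u)) (wassocV_tens _ ua vb wd).
  by apply: rpredZ; rewrite mulgA; do 2 (apply: gtens_mem => //).
move=> /subvP/(_ s sy); rewrite -!memv_preim comp_lfunE.
by rewrite (linfunE ((tens_bilin _ _).1 u)).
Qed.

Lemma gspan_extl (I : finType) (d : I -> G) (U : vectType F)
    (f g : gspan F d -> U) : linear f -> linear g ->
  (forall i, f (gdelta F i) = g (gdelta F i)) -> f =1 g.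
Proof.
move=> lf lg fg v; rewrite [v]gdelta_sum.
by rewrite !linearf_sum //; apply: eq_bigr => i _; rewrite fg.
Qed.

Definition gunit : gvect F G := gspan F (fun _ : unit => 1%g).

Lemma gunit_mem (k : gunit) : k \in gcomp gunit 1%g.
Proof. by apply/gspan_compP => i; rewrite eqxx. Qed.

Lemma gunitE (k : gunit) : k = (k : {ffun unit -> F^o}) tt *: gdelta F tt.
Proof. by rewrite {1}[k]gdelta_sum (big_pred1 tt) // => - []. Qed.

Definition wlunit (c : G -> F) V : 'Hom(gtens gunit V, V) :=
  tlift (fun (k : gunit) v => (k : {ffun unit -> F^o}) tt *: gscale c V v).
Definition wrunit (c : G -> F) V : 'Hom(gtens V gunit, V) :=
  tlift (fun v (k : gunit) => (k : {ffun unit -> F^o}) tt *: gscale c V v).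

Lemma wlunit_tens c V x k v : v \in gcomp V x ->
  wlunit c V (tens (k : gunit) v) = (k : {ffun unit -> F^o}) tt *: (c x *: v).
Proof.
move=> vx; rewrite /wlunit tlift_tens ?(gscaleE c vx) //; split=> y l s t /=.
  by rewrite linearP scalerDr !scalerA mulrC.
by rewrite !ffunE scalerDl scalerA.
Qed.

Lemma wrunit_tens c V x k v : v \in gcomp V x ->
  wrunit c V (tens v (k : gunit)) = (k : {ffun unit -> F^o}) tt *: (c x *: v).
Proof.
move=> vx; rewrite /wrunit tlift_tens ?(gscaleE c vx) //; split=> y l s t /=.
  by rewrite !ffunE scalerDl scalerA.
by rewrite linearP scalerDr !scalerA mulrC.
Qed.

Fact wlunit_subproof c V : homogeneous (wlunit c V).
Proof.
apply/homogeneousP => x t tx; rewrite memv_preim; apply: subvP t tx.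
apply: gtens_comp_subP => a b k v <- /gspan_compP k1 vb; rewrite -memv_preim.
rewrite (wlunit_tens _ _ vb); have [<-|/(k1 tt)->] := eqVneq 1%g a.
  by rewrite mul1g !rpredZ.
by rewrite scale0r mem0v.
Qed.

Fact wrunit_subproof c V : homogeneous (wrunit c V).
Proof.
apply/homogeneousP => x t tx; rewrite memv_preim; apply: subvP t tx.
apply: gtens_comp_subP => a b v k <- va /gspan_compP k1; rewrite -memv_preim.
rewrite (wrunit_tens _ _ va); have [<-|/(k1 tt)->] := eqVneq 1%g b.
  by rewrite mulg1 !rpredZ.
by rewrite scale0r mem0v.
Qed.

End TwistedVect.

Section VectTwisted.
Variables (F : fieldType) (G : finGroupType) (w : cocycle3 F G).
Implicit Types V W U T : gvect F G.

Definition vt_assoc U V W : ghom (gtens (gtens U V) W) (gtens U (gtens V W)) :=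
  Sub _ (wassoc_subproof w U V W).

Definition vt_assocV U V W : ghom (gtens U (gtens V W)) (gtens (gtens U V) W) :=
  Sub _ (wassocV_subproof (fun a b c => (w a b c)^-1) U V W).

(* For a normalized cocycle these weights are 1; in general they are what the
   triangle axiom requires. *)
Definition vt_lunit V : ghom (gtens (gunit F G) V) V :=
  Sub _ (wlunit_subproof (fun c => (w 1%g 1%g c)^-1) V).

Definition vt_runit V : ghom (gtens V (gunit F G)) V :=
  Sub _ (wrunit_subproof (fun a => w a 1%g 1%g) V).

Fact vt_tensm1 V W : gtensm (ghom_id V) (ghom_id W) = ghom_id (gtens V W).
Proof.
apply/val_inj/gtens_ext => a b v u _ _ /=.
by rewrite tmap_tens !id_lfunE.
Qed.

Fact vt_tensmM V V' V'' W W' W'' (g : ghom V' V'') (f : ghom V V')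
    (g' : ghom W' W'') (f' : ghom W W') :
  gtensm (ghom_comp g f) (ghom_comp g' f') =
  ghom_comp (gtensm g g') (gtensm f f').
Proof.
apply/val_inj/gtens_ext => a b v u _ _ /=.
by rewrite comp_lfunE !tmap_tens !comp_lfunE.
Qed.

Fact vt_assoc_iso U V W :
  is_iso (C := gvect_category F G) (vt_assoc U V W).
Proof.
exists (vt_assocV U V W); split; apply/val_inj.
  apply/gtens_ext3 => a b c u v t ua vb tc /=.
  rewrite comp_lfunE id_lfunE (wassoc_tens _ ua vb tc) lfunZ /=.
  by rewrite (wassocV_tens _ ua vb tc) scalerA mulfV ?c3_neq0 // scale1r.
apply/gtens_ext3r => a b c u v t ua vb tc /=.
rewrite comp_lfunE id_lfunE (wassocV_tens _ ua vb tc) lfunZ /=.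
by rewrite (wassoc_tens _ ua vb tc) scalerA mulVf ?c3_neq0 // scale1r.
Qed.

Fact vt_unitV_subproof (c : G -> F) V :
  homogeneous (linfun (fun v : V => tens (gdelta F tt) (gscale c V v))
    : 'Hom(V, gtens (gunit F G) V)).
Proof.
apply/homogeneousP => x v vx; rewrite linfunE; last first.
  by move=> k y z; rewrite linearP (tens_bilin _ _).1.
rewrite (gscaleE c vx) tensZr rpredZ //.
by have := gtens_mem (gunit_mem (gdelta F tt)) vx; rewrite mul1g.
Qed.

Fact vt_unitV'_subproof (c : G -> F) V :
  homogeneous (linfun (fun v : V => tens (gscale c V v) (gdelta F tt))
    : 'Hom(V, gtens V (gunit F G))).
Proof.
apply/homogeneousP => x v vx; rewrite linfunE; last first.
  by move=> k y z; rewrite linearP (tens_bilin _ _).2.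
rewrite (gscaleE c vx) tensZl rpredZ //.
by have := gtens_mem vx (gunit_mem (gdelta F tt)); rewrite mulg1.
Qed.

Fact vt_lunit_iso V : is_iso (C := gvect_category F G) (vt_lunit V).
Proof.
have n0 := c3_neq0 w.
have lE x (v : V) : v \in gcomp V x ->
    linfun (fun v : V => tens (gdelta F tt)
      (gscale (fun x => w 1%g 1%g x) V v) : gtens (gunit F G) V) v =
    w 1%g 1%g x *: tens (gdelta F tt) v.
  move=> vx; rewrite linfunE ?(gscaleE _ vx) ?tensZr //.
  by move=> k y z; rewrite linearP (tens_bilin _ _).1.
exists (Sub _ (vt_unitV_subproof (fun x => w 1%g 1%g x) V)); split; apply/val_inj.
  apply/gtens_ext => a b k v _ vb /=; rewrite comp_lfunE (wlunit_tens _ _ vb).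
  rewrite id_lfunE !lfunZ /= (lE _ _ vb) scalerA [in LHS]scalerA.
  by rewrite mulrVK ?unitfE // -tensZl -gunitE.
apply/lfunP/gextl; try exact: linear_lfun.
move=> x v vx; rewrite /= comp_lfunE (lE _ _ vx) lfunZ /=.
rewrite (wlunit_tens _ _ vx) ffunE eqxx scale1r scalerA mulfV // scale1r.
by rewrite id_lfunE.
Qed.

Fact vt_runit_iso V : is_iso (C := gvect_category F G) (vt_runit V).
Proof.
have n0 := c3_neq0 w.
have lE x (v : V) : v \in gcomp V x ->
    linfun (fun v : V => tens (gscale (fun x => (w x 1%g 1%g)^-1) V v)
      (gdelta F tt) : gtens V (gunit F G)) v =
    (w x 1%g 1%g)^-1 *: tens v (gdelta F tt).
  move=> vx; rewrite linfunE ?(gscaleE _ vx) ?tensZl //.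
  by move=> k y z; rewrite linearP (tens_bilin _ _).2.
exists (Sub _ (vt_unitV'_subproof (fun x => (w x 1%g 1%g)^-1) V)).
split; apply/val_inj.
  apply/gtens_ext => a b v k va _ /=; rewrite comp_lfunE (wrunit_tens _ _ va).
  rewrite id_lfunE !lfunZ /= (lE _ _ va) scalerA [in LHS]scalerA.
  by rewrite mulrK ?unitfE // -tensZr -gunitE.
apply/lfunP/gextl; try exact: linear_lfun.
move=> x v vx; rewrite /= comp_lfunE (lE _ _ vx) lfunZ /=.
rewrite (wrunit_tens _ _ vx) ffunE eqxx scale1r scalerA mulVf // scale1r.
by rewrite id_lfunE.
Qed.

Fact vt_assoc_nat U U' V V' W W' (f : ghom U U') (g : ghom V V')
    (h : ghom W W') :
  ghom_comp (vt_assoc U' V' W') (gtensm (gtensm f g) h) =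
  ghom_comp (gtensm f (gtensm g h)) (vt_assoc U V W).
Proof.
apply/val_inj/gtens_ext3 => a b c u v t ua vb tc /=.
rewrite !comp_lfunE (wassoc_tens _ ua vb tc) lfunZ /= !tmap_tens.
by rewrite (wassoc_tens _ (ghomP f ua) (ghomP g vb) (ghomP h tc)).
Qed.

Fact vt_lunit_nat V V' (f : ghom V V') :
  ghom_comp (vt_lunit V') (gtensm (ghom_id _) f) = ghom_comp f (vt_lunit V).
Proof.
apply/val_inj/gtens_ext => a b k v _ vb /=; rewrite !comp_lfunE tmap_tens.
rewrite id_lfunE (wlunit_tens _ _ vb) (wlunit_tens _ _ (ghomP f vb)).
by rewrite !lfunZ.
Qed.

Fact vt_runit_nat V V' (f : ghom V V') :
  ghom_comp (vt_runit V') (gtensm f (ghom_id _)) = ghom_comp f (vt_runit V).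
Proof.
apply/val_inj/gtens_ext => a b v k va _ /=; rewrite !comp_lfunE tmap_tens.
rewrite id_lfunE (wrunit_tens _ _ va) (wrunit_tens _ _ (ghomP f va)).
by rewrite !lfunZ.
Qed.

Fact vt_pentagon U V W T :
  ghom_comp (vt_assoc U V (gtens W T)) (vt_assoc (gtens U V) W T) =
  ghom_comp (gtensm (ghom_id U) (vt_assoc V W T))
    (ghom_comp (vt_assoc U (gtens V W) T) (gtensm (vt_assoc U V W) (ghom_id T))).
Proof.
apply/val_inj/gtens_ext4 => a b c d u v s t ua vb sc td /=.
rewrite !comp_lfunE (wassoc_tens _ (tens_mem ua vb) sc td) lfunZ /=.
rewrite (wassoc_tens _ ua vb (tens_mem sc td)) tmap_tens id_lfunE.
rewrite (wassoc_tens _ ua vb sc) tensZl !lfunZ /=.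
rewrite (wassoc_tens _ ua (tens_mem vb sc) td) lfunZ /= tmap_tens id_lfunE.
rewrite (wassoc_tens _ vb sc td) tensZr !scalerA; congr (_ *: _).
by rewrite -c3P; ring.
Qed.

Fact vt_triangle U V :
  ghom_comp (gtensm (ghom_id U) (vt_lunit V)) (vt_assoc U (gunit F G) V) =
  gtensm (vt_runit U) (ghom_id V).
Proof.
apply/val_inj/gtens_ext3 => a b c u k v ua kb vc /=.
have k1 := gunit_mem k; rewrite comp_lfunE (wassoc_tens _ ua k1 vc) lfunZ /=.
rewrite !tmap_tens !id_lfunE (wlunit_tens _ _ vc) (wrunit_tens _ _ ua).
rewrite !tensZl !tensZr !scalerA; congr (_ *: _).
have E : w 1%g 1%g c * w a 1%g 1%g = w a 1%g c.
  apply: (mulfI (c3_neq0 w a 1%g c)).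
  have := c3P w a 1%g 1%g c; rewrite !(mulg1, mul1g) => <-.
  by rewrite mulrA [w a _ _ * _]mulrC.
by rewrite -E; field; rewrite c3_neq0.
Qed.

Definition vect_twisted : monoidal :=
  @Monoidal (gvect_category F G) (gunit F G) (@gtens F G) (@gtensm F G)
    vt_assoc vt_lunit vt_runit vt_tensm1 vt_tensmM vt_assoc_iso vt_lunit_iso
    vt_runit_iso vt_assoc_nat vt_lunit_nat vt_runit_nat vt_pentagon vt_triangle.

End VectTwisted.

Section SpanAlgebra.
Variables (F : fieldType) (G : finGroupType) (w : cocycle3 F G).
Variables (I : finType) (d : I -> G) (m : I -> I -> I) (c : I -> I -> F) (i0 : I).
Hypothesis dM : forall i j, d (m i j) = (d i * d j)%g.
Hypothesis d1 : d i0 = 1%g.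
Hypothesis mA : forall i j k, m (m i j) k = m i (m j k).
Hypothesis m1i : forall i, m i0 i = i.
Hypothesis mi1 : forall i, m i i0 = i.
Hypothesis cA : forall i j k,
  c i j * c (m i j) k = w (d i) (d j) (d k) * (c j k * c i (m j k)).
Hypothesis c1i : forall i, c i0 i = (w 1%g 1%g (d i))^-1.
Hypothesis ci1 : forall i, c i i0 = w (d i) 1%g 1%g.

Let A : gvect F G := gspan F d.
Let e (i : I) : A := gdelta F i.

Let eP i : e i \in gcomp A (d i).
Proof. exact: gdelta_mem. Qed.

(* The product of the basis vectors at [i] and [j] is [c i j] times the basis
   vector at [m i j], and the unit is the basis vector at [i0]. *)
Definition span_mul : 'Hom(gtens A A, A) :=
  tlift (fun u v : A => \sum_i \sum_j
    ((u : {ffun I -> F^o}) i * (v : {ffun I -> F^o}) j * c i j) *: e (m i j)).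

Definition span_one : 'Hom(gunit F G, A) :=
  linfun (fun k : gunit F G => (k : {ffun unit -> F^o}) tt *: e i0).

Lemma span_mulE i j : span_mul (tens (e i) (e j)) = c i j *: e (m i j).
Proof.
rewrite /span_mul tlift_tens; last first.
  split=> u k x y; rewrite scaler_sumr -big_split; apply: eq_bigr => p _ /=;
  rewrite scaler_sumr -big_split; apply: eq_bigr => q _ /=;
  rewrite scalerA -scalerDl !ffunE; congr (_ *: _); rewrite /GRing.scale /=; ring.
rewrite (bigD1 i) //= (bigD1 j) //= !ffunE !eqxx !mul1r big1 ?addr0.
  rewrite big1 ?addr0 // => p /negPf pi; rewrite big1 // => q _.
  by rewrite !ffunE pi !mul0r scale0r.
by move=> q /negPf qj; rewrite !ffunE qj mulr0 mul0r scale0r.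
Qed.

Lemma span_oneE (k : gunit F G) :
  span_one k = (k : {ffun unit -> F^o}) tt *: e i0.
Proof.
by rewrite /span_one linfunE // => l x y; rewrite !ffunE scalerDl scalerA.
Qed.

Fact span_mul_subproof : homogeneous span_mul.
Proof.
apply/homogeneousP => x t tx; rewrite memv_preim; apply: subvP t tx.
apply: gtens_comp_subP => a b u v <- ua vb; rewrite -memv_preim.
rewrite [u]gdelta_sum [v]gdelta_sum.
have [t1 t2] := tens_bilin A A.
rewrite (linearf_sum _ _ _ _ (t2 _)) lfun_sum; apply: rpred_sum => i _ /=.
rewrite (linearf_sum _ _ _ _ (t1 _)) lfunZ lfun_sum /=.
have [<-|di] := eqVneq (d i) a; last first.
  by move/gspan_compP: ua => ->; rewrite // scale0r mem0v.
apply: rpredZ; apply: rpred_sum => j _; rewrite lfunZ.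
have [<-|dj] := eqVneq (d j) b; last first.
  by move/gspan_compP: vb => ->; rewrite // scale0r mem0v.
by rewrite span_mulE -dM !rpredZ //; apply: eP.
Qed.

Fact span_one_subproof : homogeneous span_one.
Proof.
apply/homogeneousP => x k /gspan_compP kx; rewrite span_oneE.
have [<-|/(kx tt)->] := eqVneq 1%g x; last by rewrite scale0r mem0v.
by rewrite -d1 rpredZ // eP.
Qed.

Let mul : ghom (gtens A A) A := Sub _ span_mul_subproof.
Let one : ghom (gunit F G) A := Sub _ span_one_subproof.

Fact span_amulA :
  ghom_comp mul (gtensm mul (ghom_id A)) =
  ghom_comp mul (ghom_comp (gtensm (ghom_id A) mul) (vt_assoc w A A A)).
Proof.
apply/val_inj/lfunP; apply: tens_extl; try exact: linear_lfun.
move=> t v; move: t; apply: tens_extl; try by apply: linear_tensl; apply: linear_lfun.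
move=> u1 u2; rewrite [u1]gdelta_sum [u2]gdelta_sum [v]gdelta_sum /=.
have tl (V W : gvect F G) (y : W) (f : I -> F) (x : I -> V) :
    tens (\sum_i f i *: x i) y = \sum_i f i *: tens (x i) y.
  by rewrite (linearf_sum _ _ _ _ ((tens_bilin V W).2 y)).
have tr (V W : gvect F G) (y : V) (f : I -> F) (x : I -> W) :
    tens y (\sum_i f i *: x i) = \sum_i f i *: tens y (x i).
  by rewrite (linearf_sum _ _ _ _ ((tens_bilin V W).1 y)).
rewrite (tl A A) (tl (gtens A A) A) !lfun_sum; apply: eq_bigr => i _.
rewrite /= (tr A A) !lfunZ (tl (gtens A A) A) !lfun_sum; congr (_ *: _).
apply: eq_bigr => j _; rewrite /= !lfunZ (tr (gtens A A) A); congr (_ *: _).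
rewrite !lfun_sum; apply: eq_bigr => k _; rewrite /= !lfunZ; congr (_ *: _).
rewrite !comp_lfunE (wassoc_tens w (eP i) (eP j) (eP k)) !lfunZ !tmap_tens.
rewrite !id_lfunE !span_mulE tensZl tensZr !lfunZ !span_mulE !scalerA mA.
by rewrite cA mulrA.
Qed.

Fact span_amul1m : ghom_comp mul (gtensm one (ghom_id A)) = vt_lunit w A.
Proof.
apply/val_inj/lfunP; apply: tens_extl; try exact: linear_lfun.
move=> k v /=; rewrite [v]gdelta_sum (linearf_sum _ _ _ _ ((tens_bilin _ _).1 k)).
rewrite !lfun_sum; apply: eq_bigr => i _; rewrite /= !lfunZ; congr (_ *: _).
rewrite comp_lfunE tmap_tens id_lfunE span_oneE (wlunit_tens _ _ (eP i)).
by rewrite tensZl lfunZ span_mulE c1i m1i.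
Qed.

Fact span_amulm1 : ghom_comp mul (gtensm (ghom_id A) one) = vt_runit w A.
Proof.
apply/val_inj/lfunP; apply: tens_extl; try exact: linear_lfun.
move=> v k /=; rewrite [v]gdelta_sum (linearf_sum _ _ _ _ ((tens_bilin _ _).2 k)).
rewrite !lfun_sum; apply: eq_bigr => i _; rewrite /= !lfunZ; congr (_ *: _).
rewrite comp_lfunE tmap_tens id_lfunE span_oneE (wrunit_tens _ _ (eP i)).
by rewrite tensZr lfunZ span_mulE ci1 mi1.
Qed.

Definition span_algebra : algebra (vect_twisted w) :=
  @Algebra (vect_twisted w) A mul one span_amulA span_amul1m span_amulm1.

End SpanAlgebra.

Section Deligne.
Variables (F : fieldType) (G1 G2 : finGroupType).
Variables (w1 : cocycle3 F G1) (w2 : cocycle3 F G2).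

Definition cocycle3_box_fun (a b c : (G1 * G2)%type) : F :=
  w1 a.1 b.1 c.1 * w2 a.2 b.2 c.2.

Fact cocycle3_box_neq0 a b c : cocycle3_box_fun a b c != 0.
Proof. by rewrite mulf_neq0 ?c3_neq0. Qed.

Fact cocycle3_boxP a b c d :
  cocycle3_box_fun b c d * cocycle3_box_fun a (b * c)%g d * cocycle3_box_fun a b c =
  cocycle3_box_fun (a * b)%g c d * cocycle3_box_fun a b (c * d)%g.
Proof.
have E1 := c3P w1 a.1 b.1 c.1 d.1; have E2 := c3P w2 a.2 b.2 c.2 d.2.
rewrite /cocycle3_box_fun /= [RHS]mulrACA -E1 -E2; ring.
Qed.

Definition cocycle3_box : cocycle3 F (G1 * G2)%type :=
  Cocycle3 cocycle3_box_neq0 cocycle3_boxP.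

(* The Deligne product of Vect(G1)^w1 and Vect(G2)^w2: its objects are
   (G1 x G2)-graded vector spaces, with V [x] W having V_a (x) W_b in degree
   (a, b), so that its associator is the product of the two associators. *)
Definition deligne_vect : monoidal := vect_twisted cocycle3_box.

End Deligne.

Section TwistedLinearization.
Variables (F : fieldType) (K : finGroupType) (X : finType).

Record left_action := LeftAction {
  lactfun :> K -> X -> X;
  lactfun1 : forall x, lactfun 1%g x = x;
  lactfunM : forall k' k x, lactfun (k' * k)%g x = lactfun k' (lactfun k x) }.

Variable act : left_action.

(* A 2-cochain on the action groupoid assigns a scalar [t x k k'] to the pair
   of composable morphisms x -> k.x -> k'.(k.x). *)
Record groupoid_cocycle2 := GroupoidCocycle2 {
  gc2fun :> X -> K -> K -> F;
  gc2_neq0 : forall x k k', gc2fun x k k' != 0;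
  gc2P : forall x k k' k'',
    gc2fun x k (k'' * k')%g * gc2fun (act k x) k' k'' =
    gc2fun x (k' * k)%g k'' * gc2fun x k k' }.

Variable tau : groupoid_cocycle2.

(* [tpi_inj]: the operators of a projective action are invertible. *)
Record twisted_rep := TwistedRep {
  tcar :> gvect F X;
  tpi : K -> 'End(tcar);
  tpi_inj : forall k, lker (tpi k) = 0%VS;
  tpi_deg : forall k x v, v \in gcomp tcar x -> tpi k v \in gcomp tcar (act k x);
  tpiM : forall x k k' v, v \in gcomp tcar x ->
    tpi (k' * k)%g v = tau x k k' *: tpi k' (tpi k v) }.

Definition is_twisted_hom (V W : twisted_rep) (f : ghom V W) : Prop :=
  forall k v, val f (@tpi V k v) = @tpi W k (val f v).

Definition twisted_hom (V W : twisted_rep) := {f | @is_twisted_hom V W f}.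

Lemma twisted_hom_eq V W (f g : twisted_hom V W) : sval f = sval g -> f = g.
Proof.
case: f g => [f fP] [g gP] /= fg; case: _ / fg gP => gP.
by rewrite (Prop_irrelevance fP gP).
Qed.

Fact twisted_id_subproof (V : twisted_rep) : is_twisted_hom (ghom_id V).
Proof. by move=> k v /=; rewrite !id_lfunE. Qed.

Fact twisted_comp_subproof V W U (g : twisted_hom W U) (f : twisted_hom V W) :
  is_twisted_hom (ghom_comp (sval g) (sval f)).
Proof. by move=> k v /=; rewrite !comp_lfunE (svalP f) (svalP g). Qed.

Definition twisted_id V : twisted_hom V V := exist _ _ (@twisted_id_subproof V).
Definition twisted_comp V W U (g : twisted_hom W U) (f : twisted_hom V W) :
  twisted_hom V U := exist _ _ (twisted_comp_subproof g f).

Fact twisted_compA V W U T (h : twisted_hom U T) (g : twisted_hom W U)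
    (f : twisted_hom V W) :
  twisted_comp h (twisted_comp g f) = twisted_comp (twisted_comp h g) f.
Proof. by apply: twisted_hom_eq; rewrite /= ghom_compA. Qed.

Fact twisted_comp1m V W (f : twisted_hom V W) :
  twisted_comp (twisted_id W) f = f.
Proof. by apply: twisted_hom_eq; rewrite /= ghom_comp1m. Qed.

Fact twisted_compm1 V W (f : twisted_hom V W) :
  twisted_comp f (twisted_id V) = f.
Proof. by apply: twisted_hom_eq; rewrite /= ghom_compm1. Qed.

Definition twisted_linearization : category :=
  Category twisted_compA twisted_comp1m twisted_compm1.

End TwistedLinearization.

Section BimoduleData.
Variables (F : fieldType) (gT hT : finGroupType) (w : cocycle3 F gT).

Definition vect_box : monoidal := deligne_vect w (cocycle3_inv w).

Let Omega := cocycle3_box w (cocycle3_inv w).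

Let OmegaE a b c : Omega a b c = w a.1 b.1 c.1 / w a.2 b.2 c.2.
Proof. by []. Qed.

Let Omega_diag a b c : Omega (a, a) (b, b) (c, c) = 1.
Proof. by rewrite OmegaE mulfV ?c3_neq0. Qed.

Let dgM (g h : gT) : ((g * h, g * h) = (g, g) * (h, h) :> gT * gT)%g.
Proof. by []. Qed.

Fact A_diag_assoc_subproof (g h k : gT) :
  1 * 1 = Omega (g, g) (h, h) (k, k) * (1 * 1) :> F.
Proof. by rewrite Omega_diag !mul1r. Qed.

Fact A_diag_unitl_subproof (g : gT) : 1 = (Omega 1%g 1%g (g, g))^-1 :> F.
Proof. by rewrite (Omega_diag 1%g 1%g g) invr1. Qed.

Fact A_diag_unitr_subproof (g : gT) : 1 = Omega (g, g) 1%g 1%g :> F.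
Proof. by rewrite (Omega_diag g 1%g 1%g). Qed.

(* The sum of the S_(g, g), with the product of the group algebra of G. *)
Definition A_diag : algebra vect_box :=
  @span_algebra F _ Omega gT (fun g => (g, g)) (fun g h => g * h)%g
    (fun _ _ => 1) 1%g dgM erefl (fun g h k => esym (mulgA g h k)) mul1g mulg1
    A_diag_assoc_subproof A_diag_unitl_subproof A_diag_unitr_subproof.

Variable i : {morphism [set: hT] >-> (gT * gT)%type}.
Variable theta : cochain2 F hT.

(* d theta = i1^* w . (i2^* w)^-1. *)
Definition trivializes : Prop := forall a b c : hT,
  d2 theta a b c =
  w (i a).1 (i b).1 (i c).1 / w (i a).2 (i b).2 (i c).2.

Hypothesis dtheta : trivializes.

Let iM h k : i (h * k)%g = (i h * i k)%g.
Proof. by rewrite morphM ?inE. Qed.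

Let i1M h k : (i (h * k)%g).1 = ((i h).1 * (i k).1)%g.
Proof. by rewrite iM. Qed.

Let i2M h k : (i (h * k)%g).2 = ((i h).2 * (i k).2)%g.
Proof. by rewrite iM. Qed.

Section AH.
Hypothesis w_norm : normalized3 w.
Hypothesis w_sym : tetrahedron_symmetric w.
Hypothesis t_norm : normalized2 theta.
Hypothesis t_sym : triangle_symmetric theta.

Let dH (h : hT) : (gT * gT)%type := ((i h).1^-1, (i h).2^-1)%g.

Let dHM h k : dH (k * h)%g = (dH h * dH k)%g.
Proof. by rewrite /dH iM /= !invMg. Qed.

Let dH1 : dH 1%g = 1%g.
Proof. by rewrite /dH morph1 /= invg1. Qed.

Let w_rev a b c : w c^-1%g b^-1%g a^-1%g = w a b c.
Proof.
have [S1 _ _] := w_sym a b c; rewrite S1.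
have [_ S2 _] := w_sym a^-1%g (a * b)%g c; rewrite S2 invrK mulKg.
have [_ _ S3] := w_sym b (a * b)^-1%g (a * b * c)%g; rewrite S3.
have [S4 _ _] := w_sym b ((a * b)^-1 * (a * b * c))%g (a * b * c)^-1%g.
rewrite S4 invrK.
have [_ S5 _] := w_sym b^-1%g (b * ((a * b)^-1 * (a * b * c)))%g (a * b * c)^-1%g.
rewrite S5.
have [S6 _ _] := w_sym (b^-1 * (b * ((a * b)^-1 * (a * b * c))))%g
  (b * ((a * b)^-1 * (a * b * c)))^-1%g
  (b * ((a * b)^-1 * (a * b * c)) * (a * b * c)^-1)%g.
rewrite S6 invrK.
by congr (w _ _ _); rewrite !(mulKg, mulKVg, mulgA, invMg, invgK, mulVg, mul1g,
  mulgV, mulgKV, mulgK, mulg1).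
Qed.

Let w11 a : w a 1%g 1%g = 1.
Proof.
have [-> _ _] := w_sym a 1%g 1%g; rewrite mulg1.
have [_ -> _] := w_sym a^-1%g a 1%g.
by rewrite mulVg w_norm !invr1.
Qed.

Fact A_theta_assoc_subproof (h k l : hT) :
  theta k h * theta l (k * h)%g =
  Omega (dH h) (dH k) (dH l) * (theta l k * theta (l * k)%g h).
Proof.
have := dtheta l k h; rewrite /d2 OmegaE /= !w_rev => <-.
by field; rewrite !c2_neq0.
Qed.

Fact A_theta_unitl_subproof (h : hT) :
  theta h 1%g = (Omega 1%g 1%g (dH h))^-1.
Proof.
rewrite OmegaE /= !w_norm divr1 invr1.
by have [-> _] := t_sym 1%g h; rewrite t_norm.
Qed.

Fact A_theta_unitr_subproof (h : hT) : theta 1%g h = Omega (dH h) 1%g 1%g.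
Proof. by rewrite OmegaE /= !w11 divr1 t_norm. Qed.

(* The twisted group algebra of H. The basis vector b_h has degree
   i(h)^-1, so that b_h b_k is a multiple of b_(kh), namely
   theta(k, h) b_(kh). With c_h := b_(h^-1), of degree i(h), this reads
   c_h c_k = theta(h, k)^-1 c_(hk) by the symmetries of theta. *)
Definition A_theta : algebra vect_box :=
  @span_algebra F _ Omega hT (fun h => ((i h).1^-1, (i h).2^-1)%g)
    (fun h k => k * h)%g (fun h k => theta k h) 1%g
    dHM dH1 (fun h k l => mulgA l k h) mulg1 mul1g
    A_theta_assoc_subproof A_theta_unitl_subproof A_theta_unitr_subproof.

End AH.

Definition GH_act_fun (k : (gT * hT)%type) (x : (gT * gT)%type) : (gT * gT)%type :=
  ((k.1 * x.1 * (i k.2).1^-1)%g, (k.1 * x.2 * (i k.2).2^-1)%g).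

Fact GH_act1 x : GH_act_fun 1%g x = x.
Proof. by case: x => a b; rewrite /GH_act_fun /= morph1 /= invg1 !mulg1 !mul1g. Qed.

Fact GH_actM k' k x : GH_act_fun (k' * k)%g x = GH_act_fun k' (GH_act_fun k x).
Proof. by rewrite /GH_act_fun /= iM /= !invMg !mulgA. Qed.

Definition GH_act : left_action (gT * hT)%type (gT * gT)%type :=
  LeftAction GH_act1 GH_actM.

Definition tau_fun (x : (gT * gT)%type) (k k' : (gT * hT)%type) : F :=
  let: (x1, x2) := x in let: (g, h) := k in let: (g', h') := k' in
  let i1 h := (i h).1 in let i2 h := (i h).2 in
  (theta h' h)^-1
  * (w g' g x1 * w (g' * g * x1 * (i1 h)^-1 * (i1 h')^-1)%g (i1 h') (i1 h)
     / w g' (g * x1 * (i1 h)^-1)%g (i1 h))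
  * (w g' (g * x2 * (i2 h)^-1)%g (i2 h)
     / (w g' g x2 * w (g' * g * x2 * (i2 h)^-1 * (i2 h')^-1)%g (i2 h') (i2 h))).

Fact tau_neq0 x k k' : tau_fun x k k' != 0.
Proof.
case: x k k' => [x1 x2] [g h] [g' h'].
by rewrite !(mulf_neq0, invr_eq0, c3_neq0, c2_neq0).
Qed.

Let t1 (x g h g' h' : gT) : F :=
  w g' g x * w (g' * g * x * h^-1 * h'^-1)%g h' h / w g' (g * x * h^-1)%g h.

Let t1P x g1 h1 g2 h2 g3 h3 :
  t1 x g1 h1 (g3 * g2)%g (h3 * h2)%g * t1 (g1 * x * h1^-1)%g g2 h2 g3 h3
    * w h3 h2 h1 =
  t1 x (g2 * g1)%g (h2 * h1)%g g3 h3 * t1 x g1 h1 g2 h2 * w g3 g2 g1.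
Proof.
pose y := (x * h1^-1)%g; pose z := (y * h2^-1 * h3^-1)%g.
have -> : x = (z * h3 * h2 * h1)%g by rewrite /z /y !mulgKV.
have := c3P w (g3 * g2 * g1 * z)%g h3 h2 h1.
have := c3P w g3 (g2 * g1 * z * h3)%g h2 h1.
have := c3P w g3 g2 (g1 * z * h3 * h2)%g h1.
have := c3P w g3 g2 g1 (z * h3 * h2 * h1)%g.
rewrite /t1 !(invMg, mulgA, mulgK, mulgKV); move: (c3_neq0 w) => n0.
have key (p1 p2 p3 p4 p5 q1 q2 q3 q4 r1 r3 r4 r5 s1 s2 s3 s5 : F) :
    p5 != 0 -> q1 != 0 -> q2 != 0 -> q4 != 0 -> r3 != 0 -> r4 != 0 -> r5 != 0 ->
    p1 * p2 * p3 = p4 * p5 -> q1 * q2 * q3 = q4 * p5 ->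
    r1 * q2 * r3 = r4 * r5 -> s1 * s2 * s3 = r4 * s5 ->
    p4 * s2 / q4 * (q3 * s3 / r3) * s1 = p2 * s5 / r5 * (p1 * r1 / q1) * p3.
  move=> p5n q1n q2n q4n r3n r4n r5n A B C D.
  have -> : p4 = p1 * p2 * p3 / p5 by rewrite A mulfK.
  have -> : q3 = q4 * p5 / (q1 * q2) by rewrite -B; field; apply/andP.
  have -> : r1 = r4 * r5 / (q2 * r3) by rewrite -C; field; apply/andP.
  have -> : s5 = s1 * s2 * s3 / r4 by rewrite D; field.
  by field; rewrite p5n q1n q2n q4n r3n r4n r5n.
by apply: key; apply: n0.
Qed.

Let tau_funE x g h k' :
  tau_fun x (g, h) k' = (theta k'.2 h)^-1
    * t1 x.1 g (i h).1 k'.1 (i k'.2).1 / t1 x.2 g (i h).2 k'.1 (i k'.2).2.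
Proof.
case: x k' => [x1 x2] [g' h'] /=; rewrite /t1.
by field; rewrite !c3_neq0 c2_neq0.
Qed.

Let t1_neq0 x g h g' h' : t1 x g h g' h' != 0.
Proof. by rewrite /t1 !(mulf_neq0, invr_eq0, c3_neq0). Qed.

Fact tauP x k k' k'' :
  tau_fun x k (k'' * k')%g * tau_fun (GH_act k x) k' k'' =
  tau_fun x (k' * k)%g k'' * tau_fun x k k'.
Proof.
case: x k k' k'' => [x1 x2] [g h] [g' h'] [g'' h''].
rewrite !tau_funE /= !iM /=.
have := t1P x1 g (i h).1 g' (i h').1 g'' (i h'').1.
have := t1P x2 g (i h).2 g' (i h').2 g'' (i h'').2.
have := dtheta h'' h' h; rewrite /d2.
have key (a1 a2 a3 a4 b1 b2 b3 b4 p q r s v w1 w2 : F) :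
    a4 != 0 -> b1 != 0 -> b2 != 0 -> b4 != 0 -> q != 0 -> r != 0 -> s != 0 ->
    v != 0 -> w1 != 0 -> w2 != 0 ->
    p * q / (r * s) = w1 / w2 -> b1 * b2 * w2 = b3 * b4 * v ->
    a1 * a2 * w1 = a3 * a4 * v ->
    r^-1 * a1 / b1 * (s^-1 * a2 / b2) = q^-1 * a3 / b3 * (p^-1 * a4 / b4).
  move=> a4n b1n b2n b4n qn rn sn vn w1n w2n E B A.
  have -> : a3 = a1 * a2 * w1 / (a4 * v) by rewrite A; field; apply/andP.
  have -> : b3 = b1 * b2 * w2 / (b4 * v) by rewrite B; field; apply/andP.
  have -> : p = w1 / w2 * (r * s) / q by rewrite -E; field; rewrite qn rn sn.
  by field; rewrite a4n b1n b2n b4n qn rn sn vn w1n w2n.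
by apply: key; first [exact: t1_neq0 | exact: c2_neq0 | exact: c3_neq0].
Qed.

Definition tau : groupoid_cocycle2 F GH_act := GroupoidCocycle2 tau_neq0 tauP.

End BimoduleData.

(* Main.v *)
Require Import Defs.
From mathcomp Require Import all_boot all_order all_algebra all_fingroup.
From mathcomp Require Import ring reals.
From mathcomp.real_closed Require Import complex.

(** Both algebras have a basis of homogeneous vectors, indexed by G and by H,
    so a bimodule structure on a graded space V amounts to two families of
    operators: L_g v = e_g . v of degree (g, g), and R_h v = v . e_h of degree
    iota(h)^-1.  The idea is that L_g and R_h are the restrictions to G and to H
    of one projective action of G x H, namely

      pi_(g,h) = R_h o L_g,   L_g = pi_(g,e),   R_h = pi_(e,h).

    Write Omega for the cocycle w [x] w^-1 of G x G and let v have degree x.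
    The bimodule axioms, read on basis vectors, become

      L_(g'g) v = Omega(g', g, x) L_g' L_g v,
      R_h' R_h v = Omega(x, iota(h)^-1, iota(h')^-1) theta(h', h) R_(h'h) v,
      R_h L_g v = Omega(g, x, iota(h)^-1) L_g R_h v,

    with g standing for (g, g) in Omega, and L_e = R_e = id.  The twist tau is
    a product of exactly these three kinds of scalars, except that it involves
    the tetrahedra of Omega with another ordering of their vertices: flipping
    two vertices turns Omega(x, iota(h)^-1, iota(h')^-1) into
    Omega(x iota(h)^-1 iota(h')^-1, iota(h'), iota(h))^-1 (tetra_flip13), and
    Omega(g, x, iota(h)^-1) into Omega(g, x iota(h)^-1, iota(h))^-1
    (tetra_flip23).  Moving R_h past L_g' in R_(h'h) L_(g'g) then gives pi the
    twist tau (bim_piM); conversely, evaluating tau on pairs with trivial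
    components returns the three relations, since Omega is 1 on degenerate
    tetrahedra and theta is 1 as soon as one argument is e.

    Nothing is done to the underlying graded space or to the linear maps, so
    the two functors are mutually inverse up to isomorphisms which are
    identities of graded spaces (bim_round_trip, rep_round_trip). *)

Set Implicit Arguments.
Unset Strict Implicit.
Unset Printing Implicit Defensive.

Import GRing.Theory.
Local Open Scope ring_scope.

(** * Extensionality of linear maps on tensor products *)

Section Separating.
Variable F : fieldType.

(** Phrased for arbitrary functions satisfying [linear] rather than bundled
    linear maps, so that it applies to the partial maps [t |-> f (tens v t)] of
    iterated tensor products; see [separating_tens]. *)
Definition separating (V : vectType F) (S : V -> Prop) : Prop :=
  forall (U : vectType F) (f g : V -> U), linear f -> linear g ->
    (forall v, S v -> f v = g v) -> f =1 g.

Lemma separating_lfun (V U : vectType F) (S : V -> Prop) (f g : 'Hom(V, U)) :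
  separating S -> (forall v, S v -> f v = g v) -> f = g.
Proof. by move=> sS fg; apply/lfunP/sS => //; apply: linear_lfun. Qed.

Definition pure_tensor (V W : vectType F) (S : V -> Prop) (T : W -> Prop)
    (t : tprod V W) : Prop :=
  exists v w, [/\ S v, T w & t = tens v w].

(** Iterating this reduces an identity of maps out of a triple tensor product to
    basis vectors of the algebras and homogeneous vectors of the module, where
    the associator is a scalar. *)
Lemma separating_tens (V W : vectType F) (S : V -> Prop) (T : W -> Prop) :
  separating S -> separating T -> separating (pure_tensor S T).
Proof.
move=> sS sT U f g lf lg fg; apply: tens_extl => // v w; move: v.
apply: sS; [exact: linear_tensl | exact: linear_tensl | move=> v Sv].
move: w; apply: sT; [exact: linear_tensr | exact: linear_tensr | move=> w Tw].
by apply: fg; exists v, w.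
Qed.

Definition homog (X : finType) (V : gvect F X) (v : V) : Prop :=
  exists x, v \in gcomp V x.

Lemma separating_homog (X : finType) (V : gvect F X) : separating (@homog X V).
Proof.
by move=> U f g lf lg fg; apply: gextl => // x v vx; apply: fg; exists x.
Qed.

Definition basis_vec (X I : finType) (d : I -> X) (v : gspan F d) : Prop :=
  exists i, v = gdelta F i.

Lemma separating_basis (X I : finType) (d : I -> X) :
  separating (@basis_vec X I d).
Proof.
move=> U f g lf lg fg v; rewrite [v]gdelta_sum !linearf_sum //.
by apply: eq_bigr => i _; rewrite fg //; exists i.
Qed.

End Separating.

Arguments homog {F X} V v.
Arguments basis_vec {F X I} d v.
Arguments separating_homog {F X} V U f g.
Arguments separating_basis {F X I} d U f g.

(** * Actions of algebras with a homogeneous basis *)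

Section Actions.
Variables (F : fieldType) (G : finGroupType) (w : cocycle3 F G).
Variable V : gvect F G.

(** The multiplication and the unit enter only through their values on basis
    vectors, so that the lemmas apply to any presentation of such an algebra. *)
Section OneAlgebra.
Variables (I : finType) (d : I -> G).
Let A : gvect F G := gspan F d.
Let e (i : I) : A := gdelta F i.
Variables (mul : ghom (gtens A A) A) (one : ghom (gunit F G) A).
Variables (m : I -> I -> I) (c : I -> I -> F) (i0 : I).
Hypothesis mulE : forall i j, val mul (tens (e i) (e j)) = c i j *: e (m i j).
Hypothesis oneE : val one (gdelta F tt) = e i0.

Let eP i : e i \in gcomp A (d i).
Proof. exact: gdelta_mem. Qed.

Lemma left_actionA (l : ghom (gtens A V) V) :
  ghom_comp l (gtensm mul (ghom_id V)) =
    ghom_comp l (ghom_comp (gtensm (ghom_id A) l) (vt_assoc w A A V)) <->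
  forall i j x v, v \in gcomp V x ->
    c i j *: val l (tens (e (m i j)) v) =
    w (d i) (d j) x *: val l (tens (e i) (val l (tens (e j) v))).
Proof.
have lhsE i j v : val (ghom_comp l (gtensm mul (ghom_id V)))
    (tens (tens (e i) (e j) : gtens A A) v) = c i j *: val l (tens (e (m i j)) v).
  by rewrite /= comp_lfunE tmap_tens id_lfunE mulE tensZl lfunZ.
have rhsE i j x v : v \in gcomp V x ->
    val (ghom_comp l (ghom_comp (gtensm (ghom_id A) l) (vt_assoc w A A V)))
      (tens (tens (e i) (e j) : gtens A A) v) =
    w (d i) (d j) x *: val l (tens (e i) (val l (tens (e j) v))).
  move=> vx; rewrite /= !comp_lfunE (wassoc_tens w (eP i) (eP j) vx) !lfunZ.
  by rewrite tmap_tens id_lfunE.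
split=> [E i j x v vx | E]; first by rewrite -lhsE E (rhsE _ _ _ _ vx).
have sep := separating_tens (separating_tens (separating_basis d)
  (separating_basis d)) (separating_homog V).
apply/val_inj/(separating_lfun sep).
move=> _ [_ [v [[_ [_ [[i ->] [j ->] ->]]] [x vx] ->]]].
by rewrite lhsE (rhsE _ _ _ _ vx) (E _ _ _ _ vx).
Qed.

Lemma left_action1 (l : ghom (gtens A V) V) :
  ghom_comp l (gtensm one (ghom_id V)) = vt_lunit w V <->
  forall x v, v \in gcomp V x -> val l (tens (e i0) v) = (w 1%g 1%g x)^-1 *: v.
Proof.
have lhsE v : val (ghom_comp l (gtensm one (ghom_id V))) (tens (gdelta F tt) v) =
    val l (tens (e i0) v).
  by rewrite /= comp_lfunE tmap_tens id_lfunE oneE.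
have rhsE x v : v \in gcomp V x ->
    val (vt_lunit w V) (tens (gdelta F tt) v) = (w 1%g 1%g x)^-1 *: v.
  by move=> vx; rewrite /= (wlunit_tens _ _ vx) ffunE eqxx scale1r.
split=> [E x v vx | E]; first by rewrite -lhsE E (rhsE _ _ vx).
have sep := separating_tens (separating_basis (fun _ : unit => 1%g : G))
  (separating_homog V).
apply/val_inj/(separating_lfun sep) => _ [_ [v [[[] ->] [x vx] ->]]].
by rewrite lhsE (rhsE _ _ vx) (E _ _ vx).
Qed.

Lemma right_actionA (r : ghom (gtens V A) V) :
  ghom_comp r (gtensm r (ghom_id A)) =
    ghom_comp r (ghom_comp (gtensm (ghom_id V) mul) (vt_assoc w V A A)) <->
  forall i j x v, v \in gcomp V x ->
    val r (tens (val r (tens v (e i))) (e j)) =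
    (w x (d i) (d j) * c i j) *: val r (tens v (e (m i j))).
Proof.
have lhsE i j v : val (ghom_comp r (gtensm r (ghom_id A)))
    (tens (tens v (e i) : gtens V A) (e j)) =
    val r (tens (val r (tens v (e i))) (e j)).
  by rewrite /= comp_lfunE tmap_tens id_lfunE.
have rhsE i j x v : v \in gcomp V x ->
    val (ghom_comp r (ghom_comp (gtensm (ghom_id V) mul) (vt_assoc w V A A)))
      (tens (tens v (e i) : gtens V A) (e j)) =
    (w x (d i) (d j) * c i j) *: val r (tens v (e (m i j))).
  move=> vx; rewrite /= !comp_lfunE (wassoc_tens w vx (eP i) (eP j)) !lfunZ.
  by rewrite tmap_tens id_lfunE mulE tensZr lfunZ scalerA.
split=> [E i j x v vx | E]; first by rewrite -lhsE E (rhsE _ _ _ _ vx).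
have sep := separating_tens (separating_tens (separating_homog V)
  (separating_basis d)) (separating_basis d).
apply/val_inj/(separating_lfun sep).
move=> _ [_ [_ [[v [_ [[x vx] [i ->] ->]]] [j ->] ->]]].
by rewrite lhsE (rhsE _ _ _ _ vx) (E _ _ _ _ vx).
Qed.

Lemma right_action1 (r : ghom (gtens V A) V) :
  ghom_comp r (gtensm (ghom_id V) one) = vt_runit w V <->
  forall x v, v \in gcomp V x -> val r (tens v (e i0)) = w x 1%g 1%g *: v.
Proof.
have lhsE v : val (ghom_comp r (gtensm (ghom_id V) one)) (tens v (gdelta F tt)) =
    val r (tens v (e i0)).
  by rewrite /= comp_lfunE tmap_tens id_lfunE oneE.
have rhsE x v : v \in gcomp V x ->
    val (vt_runit w V) (tens v (gdelta F tt)) = w x 1%g 1%g *: v.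
  by move=> vx; rewrite /= (wrunit_tens _ _ vx) ffunE eqxx scale1r.
split=> [E x v vx | E]; first by rewrite -lhsE E (rhsE _ _ vx).
have sep := separating_tens (separating_homog V)
  (separating_basis (fun _ : unit => 1%g : G)).
apply/val_inj/(separating_lfun sep) => _ [v [_ [[x vx] [[] ->] ->]]].
by rewrite lhsE (rhsE _ _ vx) (E _ _ vx).
Qed.

Lemma left_homP (V' : gvect F G) (l : ghom (gtens A V) V)
    (l' : ghom (gtens A V') V') (f : ghom V V') :
  ghom_comp f l = ghom_comp l' (gtensm (ghom_id A) f) <->
  forall i v, val f (val l (tens (e i) v)) = val l' (tens (e i) (val f v)).
Proof.
have E2 i v : val (ghom_comp l' (gtensm (ghom_id A) f)) (tens (e i) v) =
    val l' (tens (e i) (val f v)).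
  by rewrite /= comp_lfunE tmap_tens id_lfunE.
split=> [E i v | E]; first by rewrite -E2 -E /= comp_lfunE.
have sep := separating_tens (separating_basis d) (separating_homog V).
apply/val_inj/(separating_lfun sep) => _ [_ [v [[i ->] _ ->]]].
by rewrite E2 -E /= comp_lfunE.
Qed.

Lemma right_homP (V' : gvect F G) (r : ghom (gtens V A) V)
    (r' : ghom (gtens V' A) V') (f : ghom V V') :
  ghom_comp f r = ghom_comp r' (gtensm f (ghom_id A)) <->
  forall i v, val f (val r (tens v (e i))) = val r' (tens (val f v) (e i)).
Proof.
have E2 i v : val (ghom_comp r' (gtensm f (ghom_id A))) (tens v (e i)) =
    val r' (tens (val f v) (e i)).
  by rewrite /= comp_lfunE tmap_tens id_lfunE.
split=> [E i v | E]; first by rewrite -E2 -E /= comp_lfunE.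
have sep := separating_tens (separating_homog V) (separating_basis d).
apply/val_inj/(separating_lfun sep) => _ [v [_ [_ [i ->] ->]]].
by rewrite E2 -E /= comp_lfunE.
Qed.

(** Conversely, any family of operators of the right degrees extends
    bilinearly to a left and to a right action map. *)
Section FromOperators.
Variable T : I -> 'End(V).

Let bilinT : bilin (fun (a : A) v => \sum_i (a : {ffun I -> F^o}) i *: T i v).
Proof.
split=> [a k x y | v k x y] /=; rewrite scaler_sumr -big_split;
  apply: eq_bigr => i _ /=.
  by rewrite linearP scalerDr !scalerA mulrC.
by rewrite !ffunE scalerDl scalerA.
Qed.

Definition left_mult : 'Hom(gtens A V, V) :=
  tlift (fun (a : A) v => \sum_i (a : {ffun I -> F^o}) i *: T i v).

Definition right_mult : 'Hom(gtens V A, V) :=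
  tlift (fun v (a : A) => \sum_i (a : {ffun I -> F^o}) i *: T i v).

Let sum_delta i v : \sum_j (e i : {ffun I -> F^o}) j *: T j v = T i v.
Proof.
rewrite (bigD1 i) //= ffunE eqxx scale1r big1 ?addr0 // => j /negPf ji.
by rewrite ffunE ji scale0r.
Qed.

Lemma left_multE i v : left_mult (tens (e i) v) = T i v.
Proof. by rewrite /left_mult tlift_tens ?sum_delta. Qed.

Lemma right_multE i v : right_mult (tens v (e i)) = T i v.
Proof.
by rewrite /right_mult tlift_tens ?sum_delta //; split; case: bilinT.
Qed.

Lemma left_mult_homogeneous :
  (forall i x v, v \in gcomp V x -> T i v \in gcomp V (d i * x)%g) ->
  homogeneous left_mult.
Proof.
move=> Tdeg; apply/homogeneousP => x t tx; rewrite memv_preim.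
apply: subvP t tx; apply: gtens_comp_subP => a b u v <- /gspan_compP ua vb.
rewrite -memv_preim /left_mult tlift_tens //; apply: rpred_sum => i _.
have [<-|/ua->] := eqVneq (d i) a; first exact/rpredZ/Tdeg.
by rewrite scale0r mem0v.
Qed.

Lemma right_mult_homogeneous :
  (forall i x v, v \in gcomp V x -> T i v \in gcomp V (x * d i)%g) ->
  homogeneous right_mult.
Proof.
move=> Tdeg; apply/homogeneousP => x t tx; rewrite memv_preim.
apply: subvP t tx; apply: gtens_comp_subP => b a v u <- vb /gspan_compP ua.
rewrite -memv_preim /right_mult tlift_tens; last by split; case: bilinT.
apply: rpred_sum => i _.
have [<-|/ua->] := eqVneq (d i) a; first exact/rpredZ/Tdeg.
by rewrite scale0r mem0v.
Qed.

End FromOperators.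

End OneAlgebra.

Section TwoAlgebras.
Variables (I J : finType) (dA : I -> G) (dB : J -> G).
Let A : gvect F G := gspan F dA.
Let B : gvect F G := gspan F dB.

Let eA i : (gdelta F i : A) \in gcomp A (dA i).
Proof. exact: gdelta_mem. Qed.

Let eB j : (gdelta F j : B) \in gcomp B (dB j).
Proof. exact: gdelta_mem. Qed.

Lemma actions_commute (l : ghom (gtens A V) V) (r : ghom (gtens V B) V) :
  ghom_comp r (gtensm l (ghom_id B)) =
    ghom_comp l (ghom_comp (gtensm (ghom_id A) r) (vt_assoc w A V B)) <->
  forall i j x v, v \in gcomp V x ->
    val r (tens (val l (tens (gdelta F i) v)) (gdelta F j)) =
    w (dA i) x (dB j) *:
      val l (tens (gdelta F i) (val r (tens v (gdelta F j)))).
Proof.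
have lhsE i j v : val (ghom_comp r (gtensm l (ghom_id B)))
    (tens (tens (gdelta F i : A) v : gtens A V) (gdelta F j : B)) =
    val r (tens (val l (tens (gdelta F i) v)) (gdelta F j)).
  by rewrite /= comp_lfunE tmap_tens id_lfunE.
have rhsE i j x v : v \in gcomp V x ->
    val (ghom_comp l (ghom_comp (gtensm (ghom_id A) r) (vt_assoc w A V B)))
      (tens (tens (gdelta F i : A) v : gtens A V) (gdelta F j : B)) =
    w (dA i) x (dB j) *:
      val l (tens (gdelta F i) (val r (tens v (gdelta F j)))).
  move=> vx; rewrite /= !comp_lfunE.
  rewrite (wassoc_tens w (eA i) vx (eB j)) !lfunZ.
  by rewrite tmap_tens id_lfunE.
split=> [E i j x v vx | E]; first by rewrite -lhsE E (rhsE _ _ _ _ vx).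
have sep := separating_tens (separating_tens (separating_basis dA)
  (separating_homog V)) (separating_basis dB).
apply/val_inj/(separating_lfun sep).
move=> _ [_ [_ [[_ [v [[i ->] [x vx] ->]]] [j ->] ->]]].
by rewrite lhsE (rhsE _ _ _ _ vx) (E _ _ _ _ vx).
Qed.

End TwoAlgebras.

End Actions.

(** * Cocycles with tetrahedral symmetry *)

(** Think of w a b c as the weight of a tetrahedron with edges a, b, c along the
    path of its vertices 0, 1, 2, 3.  The three symmetries are the inversions
    under the transpositions (0 1), (1 2), (2 3), and the weight is 1 when
    the vertices 0 and 1 coincide. *)
Section TetrahedralCocycle.
Variables (F : fieldType) (G : finGroupType) (w : cocycle3 F G).
Hypothesis w_norm : normalized3 w.
Hypothesis w_sym : tetrahedron_symmetric w.

(** Here the vertices 1 and 2 coincide: the cycle (0 1)(1 2) moves them to the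
    front. *)
Lemma tetra_mid1 a c : w a 1%g c = 1.
Proof.
have [-> _ _] := w_sym a 1%g c.
have [_ -> _] := w_sym a^-1%g (a * 1)%g c.
by rewrite mulg1 mulVg w_norm !invr1.
Qed.

(** Here the vertices 2 and 3 coincide: four transpositions move them to the
    front. *)
Lemma tetra_last1 a b : w a b 1%g = 1.
Proof.
have [_ -> _] := w_sym a b 1%g.
have [-> _ _] := w_sym (a * b)%g b^-1%g (b * 1)%g.
have [_ _ ->] := w_sym (a * b)^-1%g (a * b * b^-1)%g (b * 1)%g.
have [_ -> _] := w_sym (a * b)^-1%g (a * b * b^-1 * (b * 1))%g (b * 1)^-1%g.
by rewrite mulg1 mulgKV mulVg w_norm !invr1.
Qed.

(** The transposition (1 3), written as (1 2)(2 3)(1 2). *)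
Lemma tetra_flip13 x a b :
  w x a^-1%g b^-1%g = (w (x * a^-1 * b^-1)%g b a)^-1.
Proof.
have [_ -> _] := w_sym x a^-1%g b^-1%g.
have [_ _ ->] := w_sym (x * a^-1)%g a^-1^-1%g (a^-1 * b^-1)%g.
have [_ -> _] :=
  w_sym (x * a^-1)%g (a^-1^-1 * (a^-1 * b^-1))%g (a^-1 * b^-1)^-1%g.
by rewrite !invgK !mulKVg invMg !invgK mulKg invrK.
Qed.

Lemma tetra_flip23 a b c : w a (b * c^-1)%g c = (w a b c^-1%g)^-1.
Proof. by have [_ _ ->] := w_sym a (b * c^-1)%g c; rewrite mulgKV. Qed.

End TetrahedralCocycle.

Section BoxCocycle.
Variables (F : fieldType) (G : finGroupType) (w : cocycle3 F G).

(** The associator of the Deligne product of Vect(G)^w and Vect(G)^(w^-1). *)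
Definition wbox : cocycle3 F (G * G)%type := cocycle3_box w (cocycle3_inv w).

Lemma wbox_normalized : normalized3 w -> normalized3 wbox.
Proof.
move=> w_norm b c; rewrite -[LHS]/(w 1%g b.1 c.1 * (w 1%g b.2 c.2)^-1).
by rewrite !w_norm invr1 mulr1.
Qed.

Lemma wbox_tetrahedral : tetrahedron_symmetric w -> tetrahedron_symmetric wbox.
Proof.
move=> w_sym a b c; have [A1 A2 A3] := w_sym a.1 b.1 c.1.
have [B1 B2 B3] := w_sym a.2 b.2 c.2; rewrite /wbox /= /cocycle3_box_fun /=.
by split; rewrite invfM /= ?[in RHS]invrK;
  [rewrite A1 B1 | rewrite A2 B2 | rewrite A3 B3]; rewrite invrK.
Qed.

End BoxCocycle.

(** * Projective actions of a group on a graded space *)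

Section ProjectiveAction.
Variables (F : fieldType) (K : finGroupType) (X : finType).
Variables (act : left_action K X) (tau : groupoid_cocycle2 F act).

(** A left inverse of P k is P k^-1, corrected by a scalar which depends on the
    degree; as P k permutes the degrees, the correction can be placed between
    the two operators, whence the argument [act k^-1 y] of tau. *)
Lemma projective_inj (V : gvect F X) (P : K -> 'End(V)) :
  (forall k x v, v \in gcomp V x -> P k v \in gcomp V (act k x)) ->
  (forall x k k' v, v \in gcomp V x ->
    P (k' * k)%g v = tau x k k' *: P k' (P k v)) ->
  P 1%g = \1%VF ->
  forall k, lker (P k) = 0%VS.
Proof.
move=> Pdeg PM P1 k.
pose c y := tau (act k^-1%g y) k k^-1%g.
have PK : (P k^-1%g \o (gscale c V \o P k))%VF = \1%VF.
  apply: (separating_lfun (separating_homog V)) => v [x vx].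
  rewrite !comp_lfunE (gscaleE c (Pdeg k x v vx)) lfunZ /c.
  by rewrite -lactfunM mulVg lactfun1 -(PM _ _ _ _ vx) mulVg P1.
apply/eqP/lker0P => u v Puv.
by rewrite -[u]id_lfunE -[v]id_lfunE -PK !comp_lfunE Puv.
Qed.

(** The operator of the identity is injective, and idempotent as tau is trivial
    there. *)
Lemma tpi1 (W : twisted_rep tau) : (forall x, tau x 1%g 1%g = 1) ->
  tpi W 1%g = \1%VF.
Proof.
move=> tau1; apply: (separating_lfun (separating_homog W)) => v [x vx].
have /lker0P inj := introT eqP (tpi_inj W 1%g).
apply: inj; rewrite id_lfunE.
by have := tpiM 1%g 1%g vx; rewrite tau1 scale1r mulg1 => <-.
Qed.

End ProjectiveAction.

(** * Bimodules and projective representations *)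

Section BimodulesAndRepresentations.
Variables (F : fieldType) (gT hT : finGroupType).
Variable w : cocycle3 F gT.
Variable iota : {morphism [set: hT] >-> (gT * gT)%type}.
Variable theta : cochain2 F hT.
Hypothesis dtheta : trivializes w iota theta.
Hypothesis w_norm : normalized3 w.
Hypothesis w_sym : tetrahedron_symmetric w.
Hypothesis t_norm : normalized2 theta.
Hypothesis t_sym : triangle_symmetric theta.

Local Notation AG := (A_diag w).
Local Notation AH := (A_theta dtheta w_norm w_sym t_norm t_sym).
Local Notation Om := (wbox w).
Local Notation dG g := (g%g, g%g).
Local Notation dH h := (iota h%g)^-1%g.
Local Notation EG := (gspan F (fun g : gT => dG g)).
Local Notation EH := (gspan F (fun h : hT => dH h)).
Local Notation tauGH := (tau dtheta).

Let Om_norm : normalized3 Om := wbox_normalized w_norm.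
Let Om_sym : tetrahedron_symmetric Om := wbox_tetrahedral w_sym.

Let Om_norm1 b c : Om (1%g, 1%g) b c = 1.
Proof. exact: Om_norm. Qed.

Lemma theta_norm_r h : theta h 1%g = 1.
Proof. by have [-> _] := t_sym 1%g h; rewrite t_norm. Qed.

(** In terms of Omega the two factors of tau, for the two components of G x G,
    merge into one. *)
Lemma tauE x g h g' h' :
  tauGH x (g, h) (g', h') = (theta h' h)^-1
    * (Om (dG g') (dG g) x
       * Om (dG (g' * g) * x * dH h * dH h')%g (iota h') (iota h)
       / Om (dG g') (dG g * x * dH h)%g (iota h)).
Proof.
case: x => x1 x2; rewrite /= /cocycle3_box_fun /=.
by field; rewrite !c3_neq0 c2_neq0.
Qed.

(** The scalar 1 is kept so that this matches the general form of the
    multiplication of an algebra with a homogeneous basis. *)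
Lemma A_diag_mulE (i j : gT) :
  val (amul AG : ghom (gtens EG EG) EG) (tens (gdelta F i) (gdelta F j)) =
  1 *: gdelta F (i * j)%g.
Proof. exact: (span_mulE _ (fun g h => g * h)%g (fun _ _ => 1)). Qed.

Lemma A_theta_mulE (i j : hT) :
  val (amul AH : ghom (gtens EH EH) EH) (tens (gdelta F i) (gdelta F j)) =
  theta j i *: gdelta F (j * i)%g.
Proof. exact: (span_mulE _ (fun g h => h * g)%g (fun h k => theta k h)). Qed.

Lemma A_diag_oneE :
  val (aone AG : ghom (gunit _ _) EG) (gdelta F tt) = gdelta F 1%g.
Proof. by rewrite [LHS]span_oneE ffunE eqxx scale1r. Qed.

Lemma A_theta_oneE :
  val (aone AH : ghom (gunit _ _) EH) (gdelta F tt) = gdelta F 1%g.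
Proof. by rewrite [LHS]span_oneE ffunE eqxx scale1r. Qed.

(** ** From a bimodule to a projective representation *)

Section OfBimodule.
Variable B : Defs.bimodule AG AH.

Definition bim_gvect : gvect F (gT * gT)%type := bcar B.
Let V := bim_gvect.
Let l : ghom (gtens EG V) V := Defs.lact B.
Let r : ghom (gtens V EH) V := Defs.ract B.

Definition bim_left (g : gT) : 'End(V) :=
  linfun (fun v : V => val l (tens (gdelta F g) v) : V).

Definition bim_right (h : hT) : 'End(V) :=
  linfun (fun v : V => val r (tens v (gdelta F h)) : V).

Lemma bim_leftE g v : bim_left g v = val l (tens (gdelta F g) v).
Proof. by rewrite /bim_left linfunE //; apply/linear_tensr/linear_lfun. Qed.

Lemma bim_rightE h v : bim_right h v = val r (tens v (gdelta F h)).
Proof. by rewrite /bim_right linfunE //; apply/linear_tensl/linear_lfun. Qed.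

Lemma bim_left_deg g x v :
  v \in gcomp V x -> bim_left g v \in gcomp V (dG g * x)%g.
Proof.
by move=> vx; rewrite bim_leftE; apply/ghomP/tens_mem => //; apply: gdelta_mem.
Qed.

Lemma bim_right_deg h x v :
  v \in gcomp V x -> bim_right h v \in gcomp V (x * dH h)%g.
Proof.
by move=> vx; rewrite bim_rightE; apply/ghomP/tens_mem => //; apply: gdelta_mem.
Qed.

Lemma bim_leftM g g' x v : v \in gcomp V x ->
  bim_left (g' * g)%g v = Om (dG g') (dG g) x *: bim_left g' (bim_left g v).
Proof.
move=> vx; rewrite !bim_leftE.
have := (left_actionA Om A_diag_mulE l).1 (lactA B) g' g x v vx.
by rewrite scale1r.
Qed.

Lemma bim_left1 : bim_left 1%g = \1%VF.
Proof.
apply: (separating_lfun (separating_homog V)) => v [x vx].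
rewrite bim_leftE id_lfunE.
have := (left_action1 Om A_diag_oneE l).1 (lact1 B) x v vx.
by rewrite Om_norm invr1 scale1r.
Qed.

Lemma bim_rightM h h' x v : v \in gcomp V x ->
  bim_right (h' * h)%g v =
  ((theta h' h)^-1 * Om (x * dH h * dH h')%g (iota h') (iota h))
    *: bim_right h' (bim_right h v).
Proof.
move=> vx; rewrite !bim_rightE.
rewrite ((right_actionA Om A_theta_mulE r).1 (ractA B) h h' x v vx) scalerA.
rewrite (tetra_flip13 Om_sym) [X in X *: _](_ : _ = 1) ?scale1r //.
by field; rewrite c2_neq0 c3_neq0.
Qed.

Lemma bim_right1 : bim_right 1%g = \1%VF.
Proof.
apply: (separating_lfun (separating_homog V)) => v [x vx].
rewrite bim_rightE id_lfunE.
have := (right_action1 Om A_theta_oneE r).1 (ract1 B) x v vx.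
by rewrite (tetra_last1 Om_norm Om_sym) scale1r.
Qed.

Lemma bim_rightl g h x v : v \in gcomp V x ->
  bim_right h (bim_left g v) =
  (Om (dG g) (x * dH h)%g (iota h))^-1 *: bim_left g (bim_right h v).
Proof.
move=> vx; rewrite !bim_leftE !bim_rightE.
rewrite ((actions_commute Om l r).1 (lractA B) g h x v vx).
by rewrite (tetra_flip23 Om_sym) invrK.
Qed.

(** The order matters for the scalars: with L_g first, no factor relates
    pi_(g,h) to its two components, as tau((g, e), (e, h)) = 1. *)
Definition bim_pi (k : (gT * hT)%type) : 'End(V) :=
  (bim_right k.2 \o bim_left k.1)%VF.

Lemma bim_piE g h v : bim_pi (g, h) v = bim_right h (bim_left g v).
Proof. by rewrite comp_lfunE. Qed.

Lemma bim_pi_deg k x v :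
  v \in gcomp V x -> bim_pi k v \in gcomp V (GH_act iota k x).
Proof.
move=> vx; rewrite comp_lfunE.
exact: (bim_right_deg k.2 (bim_left_deg k.1 vx)).
Qed.

(** Expand R_(h'h) L_(g'g) and move R_h past L_g': each of the three factors
    of tau comes from one of these three steps. *)
Lemma bim_piM x k k' v : v \in gcomp V x ->
  bim_pi (k' * k)%g v = tauGH x k k' *: bim_pi k' (bim_pi k v).
Proof.
case: k k' => [g h] [g' h'] vx; rewrite tauE !bim_piE.
rewrite (bim_leftM g g' vx) lfunZ.
have v1 := bim_left_deg g vx; have v2 := bim_left_deg g' v1.
rewrite (bim_rightM h h' v2) (bim_rightl g' h v1) !lfunZ !scalerA.
congr (_ *: _); rewrite !mulgA.
rewrite -[dG (g' * g)]/(dG g' * dG g)%g.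
by rewrite mulrCA -!mulrA.
Qed.

Lemma bim_pi1 : bim_pi 1%g = \1%VF.
Proof. by rewrite /bim_pi bim_left1 bim_right1 comp_lfun1l. Qed.

Definition rep_of_bimodule : twisted_rep tauGH :=
  @TwistedRep F _ _ (GH_act iota) tauGH V bim_pi
    (projective_inj bim_pi_deg bim_piM bim_pi1) bim_pi_deg bim_piM.

End OfBimodule.

(** ** From a projective representation to a bimodule *)

Section OfRep.
Variable W : twisted_rep tauGH.
Let V : gvect F (gT * gT)%type := tcar W.

Let L (g : gT) : 'End(V) := tpi W (g, 1%g).
Let R (h : hT) : 'End(V) := tpi W (1%g, h).

Let Ldeg g x v : v \in gcomp V x -> L g v \in gcomp V (dG g * x)%g.
Proof.
move=> /(tpi_deg (g, 1%g)).
by rewrite -[GH_act _ _ _]/(dG g * x * (iota 1)^-1)%g morph1 invg1 mulg1.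
Qed.

Let Rdeg h x v : v \in gcomp V x -> R h v \in gcomp V (x * dH h)%g.
Proof.
move=> /(tpi_deg (1%g, h)).
by rewrite -[GH_act _ _ _]/(1 * x * dH h)%g mul1g.
Qed.

Lemma rep_left_homogeneous : homogeneous (left_mult (fun g => dG g) L).
Proof. exact: left_mult_homogeneous. Qed.

Lemma rep_right_homogeneous : homogeneous (right_mult (fun h => dH h) R).
Proof. exact: right_mult_homogeneous. Qed.

Let l : ghom (gtens EG V) V := Sub _ rep_left_homogeneous.
Let r : ghom (gtens V EH) V := Sub _ rep_right_homogeneous.

Let lE g v : val l (tens (gdelta F g) v) = L g v.
Proof. exact: left_multE. Qed.

Let rE h v : val r (tens v (gdelta F h)) = R h v.
Proof. exact: right_multE. Qed.

Let tau11 x : tauGH x (1%g, 1%g) (1%g, 1%g) = 1.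
Proof.
rewrite tauE morph1 !Om_norm1 (tetra_last1 Om_norm Om_sym) t_norm.
by rewrite invr1 !mulr1.
Qed.

Let pi1 : tpi W 1%g = \1%VF.
Proof. exact: tpi1. Qed.

Let LM g g' x v : v \in gcomp V x ->
  L (g' * g)%g v = Om (dG g') (dG g) x *: L g' (L g v).
Proof.
move=> vx; have := tpiM (g, 1%g) (g', 1%g) vx.
rewrite -[((g', _) * (g, _))%g]/((g' * g)%g, (1 * 1)%g) mulg1 => ->.
congr (_ *: _); rewrite tauE morph1 !(tetra_last1 Om_norm Om_sym) t_norm.
by rewrite invr1 !mulr1 mul1r.
Qed.

Let RM h h' x v : v \in gcomp V x ->
  R (h' * h)%g v =
  ((theta h' h)^-1 * Om (x * dH h * dH h')%g (iota h') (iota h))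
    *: R h' (R h v).
Proof.
move=> vx; have := tpiM (1%g, h) (1%g, h') vx.
rewrite -[((_, h') * (_, h))%g]/((1 * 1)%g, (h' * h)%g) mulg1 => ->.
congr (_ *: _); rewrite tauE !Om_norm1 mulg1 !mul1g.
by rewrite invr1 !mulr1 mul1r.
Qed.

(* tau((g, e), (e, h)) = 1. *)
Let piE g h v : tpi W (g, h) v = R h (L g v).
Proof.
suff -> : tpi W (g, h) = (R h \o L g)%VF by rewrite comp_lfunE.
apply: (separating_lfun (separating_homog V)) => {}v [x vx].
have := tpiM (g, 1%g) (1%g, h) vx.
rewrite -[((_, h) * (g, _))%g]/((1 * g)%g, (h * 1)%g) mulg1 mul1g.
rewrite comp_lfunE => ->.
rewrite tauE !Om_norm1 morph1 (tetra_last1 Om_norm Om_sym) theta_norm_r.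
by rewrite !invr1 !mulr1 scale1r.
Qed.

(* Compare the two factorizations of (g, h), through (g, e) and (e, h). *)
Let RL g h x v : v \in gcomp V x ->
  R h (L g v) = Om (dG g) x (dH h) *: L g (R h v).
Proof.
move=> vx; rewrite -piE; have := tpiM (1%g, h) (g, 1%g) vx.
rewrite -[((g, _) * (_, h))%g]/((g * 1)%g, (1 * h)%g) mulg1 mul1g => ->.
congr (_ *: _); rewrite tauE morph1 t_norm !(tetra_mid1 Om_norm Om_sym).
by rewrite !mul1g (tetra_flip23 Om_sym) invr1 !mul1r invrK.
Qed.

Fact rep_lactA :
  ghom_comp l (gtensm (amul AG : ghom (gtens EG EG) EG) (ghom_id V)) =
  ghom_comp l (ghom_comp (gtensm (ghom_id EG) l) (vt_assoc Om EG EG V)).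
Proof.
apply/(left_actionA Om A_diag_mulE l) => g' g x v vx.
by rewrite !lE (LM _ _ vx) scale1r.
Qed.

Fact rep_lact1 :
  ghom_comp l (gtensm (aone AG : ghom (gunit _ _) EG) (ghom_id V)) =
  vt_lunit Om V.
Proof.
apply/(left_action1 Om A_diag_oneE l) => x v vx.
by rewrite lE Om_norm invr1 scale1r [L _]pi1 id_lfunE.
Qed.

Fact rep_ractA :
  ghom_comp r (gtensm r (ghom_id EH)) =
  ghom_comp r (ghom_comp
    (gtensm (ghom_id V) (amul AH : ghom (gtens EH EH) EH))
    (vt_assoc Om V EH EH)).
Proof.
apply/(right_actionA Om A_theta_mulE r) => h h' x v vx.
rewrite !rE (RM _ _ vx) scalerA.
rewrite (tetra_flip13 Om_sym) [X in X *: _](_ : _ = 1) ?scale1r //.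
by field; rewrite c2_neq0 c3_neq0.
Qed.

Fact rep_ract1 :
  ghom_comp r (gtensm (ghom_id V) (aone AH : ghom (gunit _ _) EH)) =
  vt_runit Om V.
Proof.
apply/(right_action1 Om A_theta_oneE r) => x v vx.
by rewrite rE (tetra_last1 Om_norm Om_sym) scale1r [R _]pi1 id_lfunE.
Qed.

Fact rep_lractA :
  ghom_comp r (gtensm l (ghom_id EH)) =
  ghom_comp l (ghom_comp (gtensm (ghom_id EG) r) (vt_assoc Om EG V EH)).
Proof.
apply/(actions_commute Om l r) => g h x v vx.
by rewrite !lE !rE (RL _ _ vx).
Qed.

Definition bimodule_of_rep : Defs.bimodule AG AH :=
  @Defs.Bimodule (vect_box w) AG AH V l r
    rep_lactA rep_lact1 rep_ractA rep_ract1 rep_lractA.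

Lemma bim_left_of_rep g : bim_left bimodule_of_rep g = tpi W (g, 1%g).
Proof. by apply/lfunP => v; rewrite bim_leftE [LHS]lE. Qed.

Lemma bim_right_of_rep h : bim_right bimodule_of_rep h = tpi W (1%g, h).
Proof. by apply/lfunP => v; rewrite bim_rightE [LHS]rE. Qed.

Lemma bim_pi_of_rep k : bim_pi bimodule_of_rep k = tpi W k.
Proof.
case: k => g h; apply/lfunP => v.
by rewrite bim_piE bim_left_of_rep bim_right_of_rep -[LHS]piE.
Qed.

End OfRep.

(** ** The equivalence *)

Lemma bimodule_homP (X Y : Defs.bimodule AG AH)
    (f : ghom (bim_gvect X) (bim_gvect Y)) :
  @is_bimodule_hom (vect_box w) AG AH X Y f <->
  (forall g v, val f (bim_left X g v) = bim_left Y g (val f v)) /\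
  (forall h v, val f (bim_right X h v) = bim_right Y h (val f v)).
Proof.
split=> -[fl fr]; split.
- move=> g v; rewrite !bim_leftE.
  exact: (left_homP (Defs.lact X) (Defs.lact Y) f).1.
- move=> h v; rewrite !bim_rightE.
  exact: (right_homP (Defs.ract X) (Defs.ract Y) f).1.
- apply/(left_homP (Defs.lact X) (Defs.lact Y) f) => g v.
  by have := fl g v; rewrite !bim_leftE.
- apply/(right_homP (Defs.ract X) (Defs.ract Y) f) => h v.
  by have := fr h v; rewrite !bim_rightE.
Qed.

(** Commuting with all pi_(g,h) amounts to commuting with all L_g and R_h,
    because L_g and R_h are themselves among the pi_(g,h). *)
Lemma bimodule_hom_pi (X Y : Defs.bimodule AG AH)
    (f : ghom (bim_gvect X) (bim_gvect Y)) :
  @is_bimodule_hom (vect_box w) AG AH X Y f <->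
  @is_twisted_hom _ _ _ _ tauGH (rep_of_bimodule X) (rep_of_bimodule Y) f.
Proof.
split=> [/bimodule_homP[fl fr] [g h] v | fP].
  by rewrite /= !bim_piE fr fl.
apply/bimodule_homP; split=> [g v | h v].
  by have := fP (g, 1%g) v; rewrite /= !bim_piE !bim_right1 !id_lfunE.
by have := fP (1%g, h) v; rewrite /= !bim_piE !bim_left1 !id_lfunE.
Qed.

Lemma twisted_hom_bimodule (X Y : twisted_rep tauGH) (f : ghom X Y) :
  is_twisted_hom f <->
  @is_bimodule_hom (vect_box w) AG AH (bimodule_of_rep X) (bimodule_of_rep Y) f.
Proof.
split=> [fP | /bimodule_hom_pi fP k v].
  by apply/bimodule_hom_pi => k v; rewrite /= !bim_pi_of_rep.
by have := fP k v; rewrite /= !bim_pi_of_rep.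
Qed.

Local Notation BimC := (bimodule_category AG AH).
Local Notation RepC := (twisted_linearization tauGH).

Definition bimodule_to_rep : functor BimC RepC.
Proof.
apply: (@Defs.Functor BimC RepC rep_of_bimodule
  (fun X Y f => exist _ (sval f) ((bimodule_hom_pi _).1 (svalP f)))).
- by move=> X; apply: twisted_hom_eq.
- by move=> X Y Z g f; apply: twisted_hom_eq.
Defined.

Definition rep_to_bimodule : functor RepC BimC.
Proof.
apply: (@Defs.Functor RepC BimC bimodule_of_rep
  (fun X Y f => exist _ (sval f) ((twisted_hom_bimodule _).1 (svalP f)))).
- by move=> X; apply: bimodule_hom_eq.
- by move=> X Y Z g f; apply: bimodule_hom_eq.
Defined.

Lemma bim_round_trip (X : Defs.bimodule AG AH) :
  let X' := bimodule_of_rep (rep_of_bimodule X) in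
  @is_bimodule_hom (vect_box w) AG AH X' X (ghom_id (bim_gvect X)) /\
  @is_bimodule_hom (vect_box w) AG AH X X' (ghom_id (bim_gvect X)).
Proof.
have El g : bim_left (bimodule_of_rep (rep_of_bimodule X)) g = bim_left X g.
  by rewrite bim_left_of_rep /= /bim_pi bim_right1 comp_lfun1l.
have Er h : bim_right (bimodule_of_rep (rep_of_bimodule X)) h = bim_right X h.
  by rewrite bim_right_of_rep /= /bim_pi bim_left1 comp_lfun1r.
split; apply/bimodule_homP; split=> [g v | h v];
  by rewrite ?El ?Er /= !id_lfunE.
Qed.

Lemma rep_round_trip (W : twisted_rep tauGH) :
  let W' := rep_of_bimodule (bimodule_of_rep W) in
  @is_twisted_hom _ _ _ _ tauGH W' W (ghom_id W) /\
  @is_twisted_hom _ _ _ _ tauGH W W' (ghom_id W).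
Proof. by split=> k v; rewrite /= bim_pi_of_rep !id_lfunE. Qed.

Lemma bimodule_equivalent : equivalent BimC RepC.
Proof.
exists bimodule_to_rep, rep_to_bimodule; split.
- exists (fun X => exist _ _ (bim_round_trip X).1).
  split=> [X | X Y f]; last first.
    by apply: bimodule_hom_eq; rewrite /= ghom_comp1m ghom_compm1.
  exists (exist _ _ (bim_round_trip X).2).
  by split; apply: bimodule_hom_eq; rewrite /= ghom_comp1m.
- exists (fun W => exist _ _ (rep_round_trip W).1).
  split=> [W | W W' f]; last first.
    by apply: twisted_hom_eq; rewrite /= ghom_comp1m ghom_compm1.
  exists (exist _ _ (rep_round_trip W).2).
  by split; apply: twisted_hom_eq; rewrite /= ghom_comp1m.
Qed.

End BimodulesAndRepresentations.

Theorem theorem4p1 (R : realType) (gT hT : finGroupType)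
    (w : cocycle3 R[i] gT)
    (iota : {morphism [set: hT] >-> (gT * gT)%type})
    (iota_inj : ('injm iota)%g)
    (theta : cochain2 R[i] hT)
    (dtheta : trivializes w iota theta)
    (w_norm : normalized3 w) (w_sym : tetrahedron_symmetric w)
    (theta_norm : normalized2 theta) (theta_sym : triangle_symmetric theta) :
  equivalent
    (bimodule_category (A_diag w)
       (A_theta dtheta w_norm w_sym theta_norm theta_sym))
    (twisted_linearization (tau dtheta)).
Proof. exact: bimodule_equivalent. Qed.
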